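(* Let $d<\infty$, let $V\subset\mathbb{B}_d$ be an analytic disc attached to the unit sphere and $f$ its embedding map, and suppose $f(-1)=f(1)$. Let $h\in\mathcal{H}_f$ be such that the limits $h(1)=\lim_{r\to1^-}h(r)$ and $h(-1)=\lim_{r\to1^-}h(-r)$ exist. Then $h(1)=h(-1)$.
   Context: $\mathbb{D}$ is the open unit disc, $\mathbb{B}_d$ the open unit ball of $\mathbb{C}^d$. The Drury–Arveson space $H^2_d$ is the RKHS on $\mathbb{B}_d$ with kernel $1/(1-\langle z,w\rangle)$, with multiplier algebra $\mathcal{M}_d$. A variety is a common zero set in $\mathbb{B}_d$ of a family of functions from $\mathcal{M}_d$. An analytic disc attached to the unit sphere is a variety $V\subset\mathbb{B}_d$ ($d<\infty$) for which there is an injective analytic $f:\mathbb{D}\to\mathbb{B}_d$ with $f'(z)\neq0$ on $\mathbb{D}$, $V=f(\mathbb{D})$, $f$ extends to a $C^2$ map on $\overline{\mathbb{D}}$, and for $x\in\overline{\mathbb{D}}$, $\|f(x)\|=1$ iff $|x|=1$ ($f$ is the embedding map). $\mathcal{H}_f$ is the RKHS on $\mathbb{D}$ with kernel $k^f(z,w)=1/(1-\langle f(z),f(w)\rangle)$. *)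

(* Defs.v *)
From HB Require Import structures.
From mathcomp Require Import all_boot all_order all_algebra.
From mathcomp Require Import all_classical all_reals all_analysis.
From mathcomp Require Import complex.
From Stdlib Require List.
Import Order.TTheory GRing.Theory Num.Theory.
Import numFieldNormedType.Exports.

Set Implicit Arguments.
Unset Strict Implicit.
Unset Printing Implicit Defensive.

Local Open Scope ring_scope.
Local Open Scope classical_set_scope.

(** The complex numbers R[i] with their usual (norm) topology: as done by
    MathComp-Analysis for realType/rcfType, we copy the normed-module structure
    of the regular module R[i]^o (norm = complex modulus) onto R[i]. *)
Section ComplexNormed.
Variable R : realType.
HB.instance Definition _ := NormedModule.copy R[i] R[i]^o.
End ComplexNormed.

Definition cR (R : realType) (r : R) : R[i] := (r%:C)%C.
Definition iC (R : realType) : R[i] := ('i)%C.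

Definition cinner (R : realType) (d : nat) (z w : 'rV[R[i]]_d) : R[i] :=
  \sum_(j < d) z 0 j * (w 0 j)^*.

Definition cnorm2 (R : realType) (d : nat) (z : 'rV[R[i]]_d) : R[i] :=
  \sum_(j < d) `|z 0 j| ^+ 2.

Definition cball (R : realType) (d : nat) : set 'rV[R[i]]_d :=
  [set z | cnorm2 z < 1].
Definition odisc (R : realType) : set R[i] := [set z | `|z| < 1].
Definition cdisc (R : realType) : set R[i] := [set z | `|z| <= 1].

(** Reproducing kernel Hilbert spaces, via the Moore–Aronszajn construction:
    the RKHS H(k) of a kernel k on a set A is the completion of
    span{k_w : w in A} (k_w = k(.,w)) with respect to
    < sum_j a_j k_{w_j}, sum_i b_i k_{v_i} > = sum_{i,j} a_j conj(b_i) k(v_i,w_j);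
    its elements are exactly the pointwise limits on A of norm-Cauchy
    sequences of finite linear combinations of kernel functions.
    A finite combination sum_j a_j k_{w_j} is encoded as a list of pairs (a_j, w_j). *)
Definition kcomb (R : realType) (T : Type) (k : T -> T -> R[i])
    (s : seq (R[i] * T)) (z : T) : R[i] :=
  \sum_(p <- s) p.1 * k z p.2.

Definition kcomb_sub (R : realType) (T : Type) (s t : seq (R[i] * T)) :=
  s ++ map (fun p => (- p.1, p.2)) t.

Definition kcomb_norm2 (R : realType) (T : Type) (k : T -> T -> R[i])
    (s : seq (R[i] * T)) : R[i] :=
  \sum_(p <- s) \sum_(q <- s) p.1 * (q.1)^* * k q.2 p.2.

Definition in_rkhs (R : realType) (T : Type) (A : set T) (k : T -> T -> R[i])
    (h : T -> R[i]) : Prop :=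
  exists g : nat -> seq (R[i] * T),
    [/\ (forall n p, List.In p (g n) -> A p.2),
        (forall z, A z -> (fun n => kcomb k (g n) z) @ \oo --> h z) &
        (forall eps : R, 0 < eps -> exists N : nat, forall m n : nat,
            (N <= m)%N -> (N <= n)%N ->
            `|kcomb_norm2 k (kcomb_sub (g m) (g n))| < cR eps)].

(** Drury–Arveson kernel on B_d, the space H^2_d and its multiplier algebra M_d
    (functions are total on C^d; only their values on B_d matter). *)
Definition DA_kernel (R : realType) (d : nat) (z w : 'rV[R[i]]_d) : R[i] :=
  (1 - cinner z w)^-1.

Definition in_H2d (R : realType) (d : nat) (h : 'rV[R[i]]_d -> R[i]) : Prop :=
  in_rkhs (@cball R d) (@DA_kernel R d) h.

Definition is_multiplier (R : realType) (d : nat) (phi : 'rV[R[i]]_d -> R[i]) : Prop :=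
  forall g, in_H2d g -> in_H2d (fun z => phi z * g z).

Definition is_variety (R : realType) (d : nat) (V : set 'rV[R[i]]_d) : Prop :=
  exists S : set ('rV[R[i]]_d -> R[i]),
    (forall phi, S phi -> is_multiplier phi) /\
    V = [set z | cball z /\ forall phi, S phi -> phi z = 0].

Definition has_rpartial (R : realType) (d : nat) (F : R[i] -> 'rV[R[i]]_d)
    (v z : R[i]) (L : 'rV[R[i]]_d) : Prop :=
  (fun t : R => (cR t)^-1 *: (F (z + cR t * v) - F z)) @ (0 : R)^' --> L.

Definition C2_on_cdisc (R : realType) (d : nat) (F : R[i] -> 'rV[R[i]]_d) : Prop :=
  {within @cdisc R, continuous F} /\
  exists (Fx Fy Fxx Fxy Fyx Fyy : R[i] -> 'rV[R[i]]_d),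
    [/\ {within @cdisc R, continuous Fx} /\ {within @cdisc R, continuous Fy},
        {within @cdisc R, continuous Fxx} /\ {within @cdisc R, continuous Fxy},
        {within @cdisc R, continuous Fyx} /\ {within @cdisc R, continuous Fyy} &
        forall z, odisc z ->
          [/\ has_rpartial F 1 z (Fx z) /\ has_rpartial F (iC R) z (Fy z),
              has_rpartial Fx 1 z (Fxx z) /\ has_rpartial Fx (iC R) z (Fxy z) &
              has_rpartial Fy 1 z (Fyx z) /\ has_rpartial Fy (iC R) z (Fyy z)]].

(** V is an analytic disc attached to the unit sphere, with embedding map f,
    and F is the (unique) C^2 extension of f to the closed disc. *)
Definition attached_disc (R : realType) (d : nat) (V : set 'rV[R[i]]_d)
    (f : R[i] -> 'rV[R[i]]_d) (F : R[i] -> 'rV[R[i]]_d) : Prop :=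
  [/\ is_variety V, V = f @` (@odisc R) &
      (forall z, odisc z -> cball (f z))] /\
  [/\ (forall z w, odisc z -> odisc w -> f z = f w -> z = w),
      (forall z, odisc z -> derivable f z 1) &
      (forall z, odisc z -> 'D_1 f z != 0)] /\
  [/\ (forall z, odisc z -> F z = f z),
      C2_on_cdisc F &
      (forall x, cdisc x -> (cnorm2 (F x) = 1 <-> `|x| = 1))].

Definition kf (R : realType) (d : nat) (f : R[i] -> 'rV[R[i]]_d) (z w : R[i]) : R[i] :=
  (1 - cinner (f z) (f w))^-1.

Definition in_Hf (R : realType) (d : nat) (f : R[i] -> 'rV[R[i]]_d) (h : R[i] -> R[i]) : Prop :=
  in_rkhs (@odisc R) (kf f) h.

(* Main.v *)
Require Import Defs.
From HB Require Import structures.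
From mathcomp Require Import all_boot all_order all_algebra.
From mathcomp Require Import all_classical all_reals all_analysis.
From mathcomp Require Import complex ring lra.
Import Order.TTheory GRing.Theory Num.Theory.
Import numFieldNormedType.Exports.
Local Open Scope ring_scope.
Local Open Scope classical_set_scope.

(** Let p = F(1) = F(-1) and phi z = <F z, p>.  Then Re phi <= 1 on the closed
    disc with equality at 1 and -1, so the normal derivatives of phi at 1 and
    -1 are real, and by the Hopf lemma for the harmonic function Re phi they are
    positive numbers a and b.  Put z_t = 1 - t/a and w_t = - (1 - t/b).  Since
    F is C^2, all of 1 - <F z_t, F z_t>, 1 - <F w_t, F w_t> and
    1 - <F z_t, F w_t> equal 2 t + O(t^2), so the leading terms 1/(2t) cancel in
    the squared norm of k_(z_t) - k_(w_t), which therefore stays bounded as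
    t -> 0+.  As k_v(z_t) - k_v(w_t) -> 0 for each v in the disc,
    k_(z_t) - k_(w_t) tends weakly to 0, and h(z_t) - h(w_t) -> 0. *)

(** * Real analysis *)

(** Separate scales at the two endpoints are forced: at the common depth [t] the leading terms of
    the squared norm would leave [(a - b)^2 / (2 a b (a + b) t)], which blows up unless [a = b].
    Errors [O(t^2)] in the denominators are what is needed, because inverting a quantity of size
    [2 t] multiplies an error by about [1 / (4 t^2)]; this is where regularity up to the boundary
    enters. Boundary derivatives exist only as continuous extensions from the open disc, so every
    expansion at an endpoint is made along a segment entering the disc, with the mean value theorem.
    The Hilbert space itself is never formed. Membership in it provides a Cauchy sequence of finite
    kernel combinations, and weak convergence becomes a Cauchy-Schwarz inequality for such
    combinations. That inequality rests only on positivity of the kernel, which comes from the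
    geometric series and Schur products. *)

(** By Fermat, [g'] vanishes at [x0]. If [k] were positive, [g'] would be positive just to the right
    of [x0], and the mean value theorem would push [g] above its maximum. *)
Lemma second_derivative_at_max (R : realType) (g g' : R -> R) (x0 k : R) :
  (\forall x \near x0, is_derive x (1 : R) g (g' x)) -> is_derive x0 (1 : R) g' k ->
  (\forall x \near x0, g x <= g x0) -> k <= 0.
Proof.
move=> dg dg' gmax.
have [e /= e0 He] : exists2 e : R, 0 < e & forall x, `|x0 - x| < e ->
    is_derive x (1 : R) g (g' x) /\ g x <= g x0.
  have : \forall x \near x0, is_derive x (1 : R) g (g' x) /\ g x <= g x0.
    by near=> x; split; near: x.
  by rewrite -nbhs_nearE => /nbhs_ballP[e /= e0 He]; exists e => // x; exact: He.
have inI t : t \in `](x0 - e), (x0 + e)[%R -> `|x0 - t| < e.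
  by rewrite in_itv /= ltr_norml => /andP[? ?]; apply/andP; split; lra.
have x0I : x0 \in `](x0 - e), (x0 + e)[%R by rewrite in_itv /=; apply/andP; split; lra.
have g'0 : g' x0 = 0.
  have D0 : is_derive x0 (1 : R) g 0.
    apply: (@derive1_at_max _ g (x0 - e) (x0 + e) x0) => //; first lra.
      by move=> t /inI /He[[]].
    by move=> t /inI /He[].
  have [[_ <-] _] := He x0 (inI _ x0I).
  by have [_ ->] := D0.
rewrite leNgt; apply/negP => k0.
have [Dg' vg'] := dg'.
have : (fun h => h^-1 *: ((g' \o shift x0) (h *: 1) - g' x0)) @ 0^' --> k.
  by rewrite -vg'; exact: Dg'.
move=> /cvgr_gt /(_ _ k0) /=.
rewrite near_withinE -nbhs_nearE => /nbhs_ballP[e2 /= e20 He2].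
have {}He2 h : 0 < h -> h < e2 -> 0 < g' (x0 + h).
  move=> h0 he2; have := He2 h.
  rewrite /ball /= sub0r normrN gtr0_norm // => /(_ he2 (lt0r_neq0 h0)).
  rewrite g'0 subr0 /= scaler1 addrC.
  by rewrite -[_ *: _]/(_ * _) pmulr_rgt0 ?invr_gt0.
pose h := Num.min e e2 / 2.
have m0 : 0 < Num.min e e2 by rewrite lt_min e0 e20.
have h0 : 0 < h by rewrite /h divr_gt0.
have [me me2] : Num.min e e2 <= e /\ Num.min e e2 <= e2.
  by split; rewrite ge_min lexx ?orbT.
have he : h < e by rewrite /h; lra.
have he2 : h < e2 by rewrite /h; lra.
have near_in t : x0 <= t -> t <= x0 + h -> `|x0 - t| < e.
  by move=> ? ?; rewrite ltr_norml; apply/andP; split; lra.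
have [|||c ci E] := @MVT R g g' x0 (x0 + h); first lra.
- move=> t ti.
  by have [] := He t (near_in t ltac:(by rewrite (itvP ti)) ltac:(by rewrite (itvP ti))).
- apply: derivable_within_continuous => t ti.
  by have [[]] := He t (near_in t ltac:(by rewrite (itvP ti)) ltac:(by rewrite (itvP ti))).
have cpos : 0 < g' c.
  have -> : c = x0 + (c - x0) by ring.
  by move: ci; rewrite in_itv /= => /andP[? ?]; apply: He2; lra.
have [|_ Hm] := He (x0 + h); first by apply: near_in; lra.
by have : 0 < g' c * (x0 + h - x0); [rewrite mulr_gt0 //; lra|lra].
Unshelve. all: by end_near. Qed.

(** Two applications of the mean value theorem: in [x] to the increment of [g] over the [y]-side,
    then in [y] to [gx] at the point found. *)
Lemma second_difference (R : realType) (g gx gxy : R -> R -> R) (x0 y0 h : R) :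
  0 < h ->
  (forall x y, x0 <= x <= x0 + h -> y0 <= y <= y0 + h ->
     is_derive x (1 : R) (g^~ y) (gx x y) /\ is_derive y (1 : R) (gx x) (gxy x y)) ->
  exists x y, [/\ x0 < x < x0 + h, y0 < y < y0 + h &
    g (x0 + h) (y0 + h) - g (x0 + h) y0 - g x0 (y0 + h) + g x0 y0 = gxy x y * h ^+ 2].
Proof.
move=> h0 H.
have Hx x y (hx : x \in `[x0, x0 + h]%R) (hy : y \in `[y0, y0 + h]%R) :
    is_derive x (1 : R) (g^~ y) (gx x y) /\ is_derive y (1 : R) (gx x) (gxy x y).
  by apply: H; [move: hx|move: hy]; rewrite in_itv.
have y0I : y0 \in `[y0, y0 + h]%R by rewrite in_itv /=; lra.
have y1I : y0 + h \in `[y0, y0 + h]%R by rewrite in_itv /=; lra.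
have sub (a b : R) : {subset `]a, b[%R <= `[a, b]%R} by move=> t; exact: subset_itv_oo_cc.
pose f x : R := g x (y0 + h) - g x y0.
have D1 x : x \in `[x0, x0 + h]%R ->
    is_derive x (1 : R) f (gx x (y0 + h) - gx x y0).
  move=> xI; have [d1 _] := Hx x (y0 + h) xI y1I.
  by have [d2 _] := Hx x y0 xI y0I; exact: is_deriveB.
have lt_x : x0 < x0 + h by rewrite ltrDl.
have lt_y : y0 < y0 + h by rewrite ltrDl.
have cf : {within `[x0, x0 + h], continuous f}.
  by apply: derivable_within_continuous => x /D1[].
have [x xI Ex] := MVT lt_x (fun x xI => D1 x (sub _ _ _ xI)) cf.
have D2 y : y \in `[y0, y0 + h]%R -> is_derive y (1 : R) (gx x) (gxy x y).
  by move=> yI; have [] := Hx x y (sub _ _ _ xI) yI.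
have cgx : {within `[y0, y0 + h], continuous (gx x)}.
  by apply: derivable_within_continuous => y /D2[].
have [y yI Ey] := MVT lt_y (fun y yI => D2 y (sub _ _ _ yI)) cgx.
exists x, y; split; [by move: xI; rewrite in_itv|by move: yI; rewrite in_itv|].
have -> : g (x0 + h) (y0 + h) - g (x0 + h) y0 - g x0 (y0 + h) + g x0 y0 =
  f (x0 + h) - f x0 by rewrite /f; ring.
by rewrite Ex Ey; ring.
Qed.

(** The second difference is symmetric in the two variables, so reading it in both orders makes
    [gxy] and [gyx] agree at two points of a small square; continuity carries both values to the
    corner. *)
Lemma mixed_partials_eq (R : realType) (g gx gy gxy gyx : R -> R -> R) (x0 y0 : R) :
  (\forall q \near (x0, y0), [/\ is_derive q.1 (1 : R) (g^~ q.2) (gx q.1 q.2),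
     is_derive q.2 (1 : R) (g q.1) (gy q.1 q.2), is_derive q.2 (1 : R) (gx q.1) (gxy q.1 q.2) &
     is_derive q.1 (1 : R) (gy^~ q.2) (gyx q.1 q.2)]) ->
  {for (x0, y0), continuous (fun q => gxy q.1 q.2)} ->
  {for (x0, y0), continuous (fun q => gyx q.1 q.2)} ->
  gxy x0 y0 = gyx x0 y0.
Proof.
move=> D c1 c2; apply/eqP; rewrite -subr_eq0 -normr_le0; apply/ler_addgt0Pr => e e0.
rewrite add0r.
have : \forall q \near (x0, y0), [/\ is_derive q.1 (1 : R) (g^~ q.2) (gx q.1 q.2),
     is_derive q.2 (1 : R) (g q.1) (gy q.1 q.2), is_derive q.2 (1 : R) (gx q.1) (gxy q.1 q.2) &
     is_derive q.1 (1 : R) (gy^~ q.2) (gyx q.1 q.2)] /\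
   (`|gxy x0 y0 - gxy q.1 q.2| < e / 2 /\ `|gyx x0 y0 - gyx q.1 q.2| < e / 2).
  have e20 : 0 < e / 2 by rewrite divr_gt0.
  near=> q; split; [by near: q|split].
    by near: q; move/cvgrPdist_lt: c1 => /(_ _ e20).
  by near: q; move/cvgrPdist_lt: c2 => /(_ _ e20).
rewrite -nbhs_nearE => /nbhs_ballP[r /= r0 Hr].
have near_in (a b : R) : a <= b <= a + r / 2 -> ball a r b.
  by rewrite /ball /= ltr_norml => /andP[? ?]; apply/andP; split; lra.
have incl (a b : R) : a < b < a + r / 2 -> a <= b <= a + r / 2.
  by move=> /andP[? ?]; apply/andP; split; lra.
have {}Hr x y (xI : x0 <= x <= x0 + r / 2) (yI : y0 <= y <= y0 + r / 2) :=
  Hr (x, y) (conj (near_in _ _ xI) (near_in _ _ yI)).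
have r20 : 0 < r / 2 by rewrite divr_gt0.
have [|x [y [xI yI E1]]] := second_difference R g gx gxy x0 y0 (r / 2) r20.
  by move=> x y xI yI; have [[]] := Hr x y xI yI.
have [|y' [x' [yI' xI' E2]]] :=
    second_difference R (fun b a => g a b) (fun b a => gy a b) (fun b a => gyx a b)
      y0 x0 (r / 2) r20.
  by move=> b a bI aI; have [[]] := Hr a b aI bI.
have E : gxy x y = gyx x' y'.
  apply: (mulIf (x := (r / 2) ^+ 2)); first by rewrite expf_neq0 // lt0r_neq0.
  by rewrite -E1 -E2; ring.
have [_ [/= h1 _]] := Hr x y (incl _ _ xI) (incl _ _ yI).
have [_ [_ /= h2]] := Hr x' y' (incl _ _ xI') (incl _ _ yI').
have -> : gxy x0 y0 - gyx x0 y0 = (gxy x0 y0 - gxy x y) - (gyx x0 y0 - gyx x' y').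
  by rewrite E; ring.
by apply: le_trans (ler_normB _ _) _; lra.
Unshelve. all: by end_near. Qed.

(** * The Hopf lemma *)

Lemma is_derive_horner (R : realType) (f : R -> R) (p : {poly R}) (t df : R) :
  (forall x, f x = p.[x]) -> p^`().[t] = df -> is_derive t (1 : R) f df.
Proof. by move=> /funext -> <-; exact: is_derive_poly. Qed.

Lemma is_derive_add (R : realType) (f g : R -> R) (t df dg : R) :
  is_derive t (1 : R) f df -> is_derive t (1 : R) g dg ->
  is_derive t (1 : R) (fun t => f t + g t) (df + dg).
Proof. by move=> d1 d2; exact: is_deriveD. Qed.

(* The barrier (1 - s) (3 - 2 s), with s = x^2 + y^2, vanishes on the unit circle
   and has Laplacian 32 s - 20, which is positive on the annulus s >= 3/4. *)
Lemma barrier_derive (R : realType) (e c t : R) :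
  is_derive t (1 : R) (fun t => e * ((1 - (t ^+ 2 + c)) * (3 - 2 * (t ^+ 2 + c))))
    (e * (8 * t ^+ 3 + (8 * c - 10) * t)).
Proof.
apply: (is_derive_horner _ _ (e%:P * ((1 - ('X^2 + c%:P)) * (3%:P - 2%:P * ('X^2 + c%:P))))).
  by move=> x; rewrite !hornerE.
by set r := RHS; rewrite !poly.derivE !hornerE {}/r; ring.
Qed.

Lemma barrier_derive2 (R : realType) (e c t : R) :
  is_derive t (1 : R) (fun t => e * (8 * t ^+ 3 + (8 * c - 10) * t))
    (e * (24 * t ^+ 2 + 8 * c - 10)).
Proof.
apply: (is_derive_horner _ _ (e%:P * (8%:P * 'X^3 + (8 * c - 10)%:P * 'X))).
  by move=> x; rewrite !hornerE.
set r := RHS; rewrite !poly.derivE !hornerE {}/r /=; ring.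
Qed.

Definition sqn2 {R : realType} (q : R * R) : R := q.1 ^+ 2 + q.2 ^+ 2.

Lemma continuous_sqn2 (R : realType) : continuous (@sqn2 R).
Proof.
move=> q; rewrite /sqn2; apply: cvgD; rewrite expr2;
  by apply: cvgM; [exact: cvg_fst|exact: cvg_fst] || (apply: cvgM; exact: cvg_snd).
Qed.

Lemma continuous_sqn2_l (R : realType) (x y : R) :
  {for x, continuous (fun a => sqn2 (a, y))}.
Proof. by apply: cvgD; [exact: exprn_continuous|exact: cst_continuous]. Qed.

Lemma continuous_sqn2_r (R : realType) (x y : R) :
  {for y, continuous (fun b => sqn2 (x, b))}.
Proof. by apply: cvgD; [exact: cst_continuous|exact: exprn_continuous]. Qed.

Lemma compact_annulus (R : realType) (a b : R) : b <= 1 ->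
  compact [set q : R * R | a <= sqn2 q <= b].
Proof.
move=> b1; pose I := `[-1 : R, 1].
apply: (@subclosed_compact _ _ (I `*` I)).
- have -> : [set q | a <= sqn2 q <= b] = sqn2 @^-1` `[a, b]%classic.
    by apply/seteqP; split => q /=; rewrite in_itv.
  apply: closed_comp; last exact: interval_closed.
  by move=> q _; exact: continuous_sqn2.
- by apply: compact_setX; exact: segment_compact.
- move=> [x y] /andP[_ le_b]; rewrite /sqn2 /= in le_b.
  by split; rewrite /I /= in_itv /=; apply/andP; split; nra.
Qed.

(** Adding [e] times the barrier to [u] gives a function [w] with positive Laplacian on the annulus,
    so its maximum lies on one of the two bounding circles, where [w] is at most 1. *)
Lemma hopf_estimate (R : realType) (u ux uy uxx uyy : R -> R -> R) :
  (forall x y, sqn2 (x, y) < 1 ->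
     [/\ is_derive x (1 : R) (u^~ y) (ux x y), is_derive y (1 : R) (u x) (uy x y),
         is_derive x (1 : R) (ux^~ y) (uxx x y), is_derive y (1 : R) (uy x) (uyy x y) &
         uxx x y + uyy x y = 0]) ->
  {within [set q : R * R | sqn2 q <= 1], continuous (fun q => u q.1 q.2)} ->
  (forall x y, sqn2 (x, y) <= 1 -> u x y <= 1) ->
  (forall x y, sqn2 (x, y) < 1 -> u x y < 1) ->
  exists2 e : R, 0 < e & forall x y, 3 / 4 <= sqn2 (x, y) <= 1 ->
    u x y <= 1 - e * (1 - sqn2 (x, y)).
Proof.
move=> D cu le1 lt1.
pose C := [set q : R * R | 3 / 4 <= sqn2 q <= 3 / 4].
pose K := [set q : R * R | 3 / 4 <= sqn2 q <= 1].
have subK (a : R) : a <= 1 ->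
    [set q : R * R | 3 / 4 <= sqn2 q <= a] `<=` [set q | sqn2 q <= 1].
  by move=> a1 q /andP[_ h]; exact: le_trans h a1.
have C0 : C !=set0.
  by exists (Num.sqrt (3 / 4), 0); rewrite /C /sqn2 /= sqr_sqrtr ?expr0n /= ?addr0 ?lexx //; lra.
have lt34 : (3 / 4 : R) <= 1 by lra.
have [[cx cy] cC cmax] := compact_EVT_max C0 (compact_annulus R _ _ lt34)
  (continuous_subspaceW (subK _ lt34) cu).
move: cC; rewrite inE => /andP[/= c1 c2].
have uc : u cx cy < 1 by apply: lt1; lra.
(* The gap below 1 on the inner circle decides how much of the barrier can be added. *)
pose e := 1 - u cx cy.
have e0 : 0 < e by rewrite /e; lra.
exists e => //.
pose w (q : R * R) := u q.1 q.2 + e * ((1 - sqn2 q) * (3 - 2 * sqn2 q)).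
have cw : {within K, continuous w}.
  move=> q; have cs : (fun x : subspace K => sqn2 x) @ q --> sqn2 q.
    exact: (continuous_subspaceT (@continuous_sqn2 R)).
  apply: cvgD; first exact: (continuous_subspaceW (subK _ (lexx 1)) cu).
  apply: cvgM; first exact: cvg_cst.
  apply: cvgM; first by apply: cvgB => //; exact: cvg_cst.
  by apply: cvgB; [exact: cvg_cst|apply: cvgM => //; exact: cvg_cst].
have K0 : K !=set0 by have [q /andP[a b]] := C0; exists q; apply/andP; split; lra.
have [[x0 y0] mK mmax] := compact_EVT_max K0 (compact_annulus R _ _ (lexx 1)) cw.
have {mK} /andP[/= m1 m2] : K (x0, y0) by rewrite inE in mK.
have {}mmax x y : 3 / 4 <= sqn2 (x, y) <= 1 -> w (x, y) <= w (x0, y0).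
  by move=> h; apply: mmax; rewrite inE.
suff w1 : w (x0, y0) <= 1.
  move=> x y xyK; have := mmax x y xyK; move: xyK => /andP[h1 h2].
  rewrite /w /=; set s := sqn2 (x, y) in h1 h2 *.
  (* The barrier dominates [1 - s], since [3 - 2 s >= 1] for [s <= 1]. *)
  have : 0 <= e * ((1 - s) * (2 - 2 * s)) by rewrite !mulr_ge0 //; lra.
  rewrite /w /= in w1; nra.
have [eq1|ne1] := eqVneq (sqn2 (x0, y0)) 1.
  by rewrite /w eq1 /=; have := le1 _ _ m2; lra.
have [eq34|ne34] := eqVneq (sqn2 (x0, y0)) (3 / 4).
  (* On the inner circle the barrier equals [1/4 * 3/2 = 3/8], less than 1, so [e] times it stays
     below the gap. *)
  rewrite /w eq34 /=.
  have : (x0, y0) \in C by rewrite inE /C /= eq34 lexx.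
  by move=> /cmax /=; rewrite /e; nra.
have {}m1 : 3 / 4 < sqn2 (x0, y0) by rewrite lt_neqAle eq_sym ne34.
have {}m2 : sqn2 (x0, y0) < 1 by rewrite lt_neqAle ne1.
have cx0 := continuous_sqn2_l R x0 y0.
have cy0 := continuous_sqn2_r R x0 y0.
have Kx : \forall x \near x0, 3 / 4 <= sqn2 (x, y0) < 1.
  near=> x; apply/andP; split; last by near: x; exact: cvgr_lt cx0 _ m2.
  by apply/ltW; near: x; exact: cvgr_gt cx0 _ m1.
have Ky : \forall y \near y0, 3 / 4 <= sqn2 (x0, y) < 1.
  near=> y; apply/andP; split; last by near: y; exact: cvgr_lt cy0 _ m2.
  by apply/ltW; near: y; exact: cvgr_gt cy0 _ m1.
have hx : uxx x0 y0 + e * (24 * x0 ^+ 2 + 8 * y0 ^+ 2 - 10) <= 0.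
  apply: (@second_derivative_at_max R (fun x => w (x, y0))
    (fun x => ux x y0 + e * (8 * x ^+ 3 + (8 * y0 ^+ 2 - 10) * x)) x0).
  - near=> x; have /andP[_ /D[d1 _ _ _ _]] : 3 / 4 <= sqn2 (x, y0) < 1 by near: x.
    exact: (is_derive_add _ _ _ _ _ _ d1 (barrier_derive R e (y0 ^+ 2) x)).
  - have [_ _ d1 _ _] := D _ _ m2.
    exact: (is_derive_add _ _ _ _ _ _ d1 (barrier_derive2 R e (y0 ^+ 2) x0)).
  - near=> x; have /andP[k1 k2] : 3 / 4 <= sqn2 (x, y0) < 1 by near: x.
    by apply: mmax; rewrite k1 ltW.
have hy : uyy x0 y0 + e * (24 * y0 ^+ 2 + 8 * x0 ^+ 2 - 10) <= 0.
  have wE y : w (x0, y) = u x0 y +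
      e * ((1 - (y ^+ 2 + x0 ^+ 2)) * (3 - 2 * (y ^+ 2 + x0 ^+ 2))).
    by rewrite /w /sqn2 /= (addrC (y ^+ 2)).
  apply: (@second_derivative_at_max R (fun y => w (x0, y))
    (fun y => uy x0 y + e * (8 * y ^+ 3 + (8 * x0 ^+ 2 - 10) * y)) y0).
  - near=> y; have /andP[_ /D[_ d1 _ _ _]] : 3 / 4 <= sqn2 (x0, y) < 1 by near: y.
    rewrite (funext wE); exact: (is_derive_add _ _ _ _ _ _ d1 (barrier_derive R e (x0 ^+ 2) y)).
  - have [_ _ _ d1 _] := D _ _ m2.
    exact: (is_derive_add _ _ _ _ _ _ d1 (barrier_derive2 R e (x0 ^+ 2) y0)).
  - near=> y; have /andP[k1 k2] : 3 / 4 <= sqn2 (x0, y) < 1 by near: y.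
    by apply: mmax; rewrite k1 ltW.
have [_ _ _ _ lap] := D _ _ m2.
(* Adding [hx] and [hy] and using harmonicity leaves [e * (32 s - 20) <= 0], impossible for
   [s > 3/4]. *)
by exfalso; rewrite /sqn2 /= in m1; nra.
Unshelve. all: by end_near. Qed.

(** * Positive kernels *)

Lemma complex_gt0P (R : realType) (x : R[i]) : 0 < x -> exists2 e : R, 0 < e & x = cR e.
Proof.
case: x => a b; rewrite ltcE /= => /andP[/eqP -> a0].
by exists a.
Qed.

Lemma cR_gt0 (R : realType) (e : R) : 0 < e -> 0 < cR e.
Proof. by rewrite ltcE /= eqxx. Qed.

Lemma cvg_complexP (R : realType) (X : Type) (G : set_system X) (FG : Filter G)
    (f : X -> R[i]) (l : R[i]) :
  (forall e : R, 0 < e -> \forall x \near G, `|l - f x| < cR e) <-> f @ G --> l.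
Proof.
split=> [H|/cvgrPdist_lt H e e0]; last by apply: H; exact: cR_gt0.
by apply/cvgrPdist_lt => x /complex_gt0P[e e0 ->]; exact: H.
Qed.

(** [List.In] replaces [\in] here because the points range over a type without decidable
    equality. *)
Lemma cvg_sum_seq (R : realType) (X I : Type) (G : set_system X) (FG : Filter G)
    (s : seq I) (f : I -> X -> R[i]) (l : I -> R[i]) :
  (forall i, List.In i s -> f i @ G --> l i) ->
  (fun x => \sum_(i <- s) f i x) @ G --> \sum_(i <- s) l i.
Proof.
elim: s => [|i s IH] H.
  by rewrite big_nil; under eq_fun do rewrite big_nil; exact: cvg_cst.
rewrite big_cons; under eq_fun do rewrite big_cons.
by apply: cvgD; [apply: H; left|apply: IH => j js; apply: H; right].
Qed.

Lemma eq_big_List (R : realType) (I : Type) (s : seq I) (f g : I -> R[i]) :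
  (forall i, List.In i s -> f i = g i) -> \sum_(i <- s) f i = \sum_(i <- s) g i.
Proof.
elim: s => [|i s IH] H; first by rewrite !big_nil.
by rewrite !big_cons H ?IH //; [move=> j js; apply: H; right|left].
Qed.

Lemma cvg_geometric_complex (R : realType) (x : R[i]) : `|x| < 1 ->
  (fun n => x ^+ n) @ \oo --> (0 : R[i]).
Proof.
move=> x1; pose r := complex.Re `|x|.
have xE : `|x| = cR r by rewrite /r {1}normc_def /cR normc_def.
have r1 : `|r| < 1.
  have : 0 <= cR r by rewrite -xE.
  rewrite /cR ler0c => r0; rewrite ger0_norm //.
  by rewrite xE -[1]/(cR 1) /cR ltcR in x1.
apply/cvg_complexP => e e0.
have /cvgrPdist_lt /(_ _ e0) := cvg_expr r1.
apply: filterS => n; rewrite !sub0r !normrN => rn.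
rewrite normrX xE; have -> : cR r ^+ n = cR (r ^+ n) by rewrite /cR rmorphXn.
by rewrite /cR ltcR; apply: le_lt_trans rn; exact: ler_norm.
Qed.

Section PositiveKernels.
Context {R : realType} {T : Type}.
Implicit Types (k : T -> T -> R[i]) (A : set T) (s t : seq (R[i] * T)).

Definition points_in A s := forall p, List.In p s -> A p.2.

Definition psd_kernel A k := forall s, points_in A s -> 0 <= kcomb_norm2 k s.

Lemma kcomb_subE k s t z : kcomb k (kcomb_sub s t) z = kcomb k s z - kcomb k t z.
Proof.
rewrite /kcomb /kcomb_sub big_cat big_map /= -sumrN; congr (_ + _).
by apply: eq_bigr => p _; rewrite mulNr.
Qed.

Lemma points_in_sub A s t : points_in A s -> points_in A t -> points_in A (kcomb_sub s t).
Proof.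
move=> sA tA p; rewrite /kcomb_sub => /List.in_app_iff[/sA//|].
by move=> /List.in_map_iff[q [<- /tA]].
Qed.

(** This is the reproducing property in finite form: the cross terms with [k_z] and [k_w] collapse
    to values of the combination at [z] and [w]. *)
Lemma kcomb_norm2_add_pair k s (l : R[i]) (z w : T) :
  (forall a b, k a b = (k b a)^*) ->
  kcomb_norm2 k (s ++ [:: (l, z); (- l, w)]) =
    kcomb_norm2 k s + l^* * (kcomb k s z - kcomb k s w)
    + l * (kcomb k s z - kcomb k s w)^*
    + l * l^* * (k z z + k w w - k z w - k w z).
Proof.
move=> herm; rewrite /kcomb_norm2 big_cat /= !big_cons !big_nil !addr0.
under eq_bigr do rewrite big_cat /= !big_cons !big_nil /= addr0.
rewrite !big_cat /= !big_cons !big_nil /= !addr0 !big_split /=.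
have E1 a b : \sum_(p <- s) p.1 * a^* * k b p.2 = a^* * kcomb k s b.
  by rewrite /kcomb mulr_sumr; apply: eq_bigr => p _; rewrite mulrAC mulrC mulrA.
have E2 a b : \sum_(q <- s) a * (q.1)^* * k q.2 b = a * (kcomb k s b)^*.
  rewrite /kcomb rmorph_sum mulr_sumr; apply: eq_bigr => q _.
  by rewrite rmorphM /= -herm mulrA.
by rewrite !E1 !E2 rmorphN rmorphB /=; ring.
Qed.

(** Cauchy-Schwarz against [k_z - k_w]. Working with a positive upper bound [M] of its squared norm
    avoids dividing by a norm that may vanish. *)
Lemma kcomb_cauchy_schwarz A k s (z w : T) (M : R) :
  psd_kernel A k -> (forall a b, k a b = (k b a)^*) -> points_in A s ->
  A z -> A w -> 0 < M -> k z z + k w w - k z w - k w z <= cR M ->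
  `|kcomb k s z - kcomb k s w| ^+ 2 <= cR M * kcomb_norm2 k s.
Proof.
move=> psd herm sA Az Aw M0 DM; set c := _ - _; set D := _ - k w z in DM.
have cM0 : 0 < cR M := cR_gt0 _ _ M0.
(* Minimiser of the quadratic polynomial N + 2 Re (conj l * c) + |l|^2 M in l. *)
pose l := - (c / cR M).
have : 0 <= kcomb_norm2 k (s ++ [:: (l, z); (- l, w)]).
  by apply: psd => p /List.in_app_iff[/sA//|[<-//|[<-//|[]]]].
rewrite kcomb_norm2_add_pair // -/c -/D.
have cMc : (cR M)^* = cR M by rewrite conj_Creal // gtr0_real.
have -> : l^* = - (c^* / cR M) by rewrite /l rmorphN rmorphM /= fmorphV /= cMc.
set N := kcomb_norm2 k s.
have -> : N + - (c^* / cR M) * c + l * c^* + l * - (c^* / cR M) * D =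
   N - (c * c^* / cR M) *+ 2 + (c * c^*) / cR M ^+ 2 * D.
  by rewrite /l; field; rewrite gt_eqF.
rewrite -normCK => H0.
have H1 : `|c| ^+ 2 / cR M ^+ 2 * D <= `|c| ^+ 2 / cR M.
  have -> : `|c| ^+ 2 / cR M = `|c| ^+ 2 / cR M ^+ 2 * cR M.
    by field; rewrite gt_eqF.
  by rewrite ler_wpM2l // divr_ge0 // exprn_ge0 // ltW.
rewrite mulrC -ler_pdivrMr //.
rewrite -subr_ge0; apply: le_trans H0 _.
have -> : N - `|c| ^+ 2 / cR M = N - (`|c| ^+ 2 / cR M) *+ 2 + `|c| ^+ 2 / cR M.
  by rewrite mulr2n; ring.
by rewrite lerD2l.
Qed.

(** A bounded family [k_z - k_w] that tends to 0 on kernel functions tends to 0 weakly. The order of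
    choices is what matters: first [N], from the Cauchy condition, then [x], then [m].
    Cauchy-Schwarz makes the passage from [g N] to [g m] uniform in [x] and [m]. *)
Lemma in_rkhs_curve_limits A k (h : T -> R[i]) (X : Type) (G : set_system X)
    (FG : ProperFilter G) (z w : X -> T) (M : R) (L1 L2 : R[i]) :
  psd_kernel A k -> (forall a b, k a b = (k b a)^*) -> in_rkhs A k h -> 0 < M ->
  (\forall x \near G, [/\ A (z x), A (w x) &
     k (z x) (z x) + k (w x) (w x) - k (z x) (w x) - k (w x) (z x) <= cR M]) ->
  (forall v, A v -> (fun x => k (z x) v - k (w x) v) @ G --> (0 : R[i])) ->
  h \o z @ G --> L1 -> h \o w @ G --> L2 -> L1 = L2.
Proof.
move=> psd herm [g [gA gh gC]] M0 DM k0 hz hw.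
apply/eqP; rewrite -subr_eq0 -normr_eq0; apply/eqP.
have [r rE] : exists r : R, `|L1 - L2| = cR r.
  by exists (complex.Re `|L1 - L2|); rewrite {1}normc_def /cR normc_def.
have r0 : 0 <= r by rewrite -ler0c -[_%:C%C]/(cR r) -rE.
rewrite rE; congr (cR _); apply/eqP; rewrite eq_le r0 andbT.
apply/ler_addgt0Pr => e' e'0; rewrite add0r.
(* The difference of the limits is split below into six pieces of size at most [e]. *)
pose e := e' / 6.
have e0 : 0 < e by rewrite /e divr_gt0.
have [N HN] := gC (e ^+ 2 / M) ltac:(by rewrite divr_gt0 // exprn_gt0).
have cN : (fun x => kcomb k (g N) (z x) - kcomb k (g N) (w x)) @ G --> (0 : R[i]).
  have -> : (fun x => kcomb k (g N) (z x) - kcomb k (g N) (w x)) =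
      (fun x => \sum_(p <- g N) p.1 * (k (z x) p.2 - k (w x) p.2)).
    apply/funext => x; rewrite /kcomb -sumrB.
    by apply: eq_bigr => p _; rewrite mulrBr.
  rewrite [X in _ --> X](_ : _ = \sum_(p <- g N) p.1 * 0); last first.
    by rewrite big1 // => p _; rewrite mulr0.
  apply: cvg_sum_seq => p pg.
  by apply: cvgM; [exact: cvg_cst|apply: k0; exact: gA pg].
have [x [[Az Aw D] Hz Hw HcN]] : exists x, [/\ [/\ A (z x), A (w x) &
     k (z x) (z x) + k (w x) (w x) - k (z x) (w x) - k (w x) (z x) <= cR M],
     `|L1 - h (z x)| < cR e, `|L2 - h (w x)| < cR e &
     `|0 - (kcomb k (g N) (z x) - kcomb k (g N) (w x))| < cR e].
  apply: (@filter_ex _ G).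
  near=> x; split; near: x; first exact: DM.
  - exact: ((cvg_complexP _ _ _ _ _ _).2 hz).
  - exact: ((cvg_complexP _ _ _ _ _ _).2 hw).
  - exact: ((cvg_complexP _ _ _ _ _ _).2 cN).
(* Only pointwise convergence to [h] is available, so [m] has to depend on [x]. *)
have [m [Nm Hmz Hmw]] : exists m, [/\ (N <= m)%N,
     `|h (z x) - kcomb k (g m) (z x)| < cR e & `|h (w x) - kcomb k (g m) (w x)| < cR e].
  apply: (@filter_ex _ \oo).
  near=> m; split; near: m; first exact: nbhs_infty_ge.
  - exact: ((cvg_complexP _ _ _ _ _ _).2 (gh _ Az)).
  - exact: ((cvg_complexP _ _ _ _ _ _).2 (gh _ Aw)).
have Hmid : `|(kcomb k (g m) (z x) - kcomb k (g N) (z x))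
     - (kcomb k (g m) (w x) - kcomb k (g N) (w x))| <= cR e.
  have pin : points_in A (kcomb_sub (g m) (g N)) by apply: points_in_sub; exact: gA.
  have := kcomb_cauchy_schwarz _ _ _ _ _ _ psd herm pin Az Aw M0 D.
  have := HN m N Nm (leqnn N).
  rewrite !kcomb_subE ger0_norm; last exact: psd.
  set nn := kcomb_norm2 _ _; set dd := `|_| => h1 h2.
  rewrite -(@ler_pXn2r _ 2) // ?nnegrE ?normr_ge0 //; last by rewrite ltW // cR_gt0.
  apply: le_trans h2 _.
  have -> : cR e ^+ 2 = cR M * cR (e ^+ 2 / M).
    by rewrite /cR -rmorphXn -rmorphM; congr (_%:C%C); field; rewrite gt_eqF.
  by rewrite ler_wpM2l ?(ltW h1) // ltW // cR_gt0.
rewrite -lecR -[r%:C%C]/(cR r) -rE.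
have -> : L1 - L2 = (L1 - h (z x)) + (h (z x) - kcomb k (g m) (z x))
   + ((kcomb k (g m) (z x) - kcomb k (g N) (z x))
     - (kcomb k (g m) (w x) - kcomb k (g N) (w x)))
   - (0 - (kcomb k (g N) (z x) - kcomb k (g N) (w x)))
   - (h (w x) - kcomb k (g m) (w x)) - (L2 - h (w x)) by ring.
have -> : e'%:C%C = cR e + cR e + cR e + cR e + cR e + cR e.
  by rewrite /cR -!rmorphD; congr (_%:C%C); rewrite /e; field.
have tri (a b c d : R[i]) : `|a| <= c -> `|b| <= d -> `|a + b| <= c + d.
  by move=> ? ?; apply: le_trans (ler_normD _ _) _; exact: lerD.
have triN (a b c d : R[i]) : `|a| <= c -> `|b| <= d -> `|a - b| <= c + d.
  by move=> ? ?; apply: tri; rewrite ?normrN.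
exact: (triN _ _ _ _ (triN _ _ _ _ (triN _ _ _ _ (tri _ _ _ _ (tri _ _ _ _
  (ltW Hz) (ltW Hmz)) Hmid) (ltW HcN)) (ltW Hmw)) (ltW Hw)).
Unshelve. all: by end_near. Qed.

End PositiveKernels.

(** * Positivity of the Drury-Arveson kernel *)

Section DruryArvesonKernel.
Context {R : realType} {T : Type} {d : nat}.
Variable y : T -> 'rV[R[i]]_d.
Implicit Types (s : seq (R[i] * T)) (u v : 'rV[R[i]]_d).

Lemma cinnerC u v : cinner v u = (cinner u v)^*.
Proof.
rewrite /cinner rmorph_sum; apply: eq_bigr => j _.
by rewrite rmorphM /= conjCK mulrC.
Qed.

(** The arithmetic-geometric mean inequality in each coordinate. For vectors of the unit ball it
    does the work of Cauchy-Schwarz without square roots. *)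
Lemma norm_cinner_mul2 u v : `|cinner u v| *+ 2 <= cnorm2 u + cnorm2 v.
Proof.
have -> : cnorm2 u + cnorm2 v = \sum_(j < d) (`|u 0 j| ^+ 2 + `|v 0 j| ^+ 2).
  by rewrite big_split.
apply: (@le_trans _ _ (\sum_(j < d) `|u 0 j * (v 0 j)^*| *+ 2)).
  by rewrite sumrMnl lerMn2r ler_norm_sum.
apply: ler_sum => j _; rewrite normrM norm_conjC.
rewrite -subr_ge0; have -> : `|u 0 j| ^+ 2 + `|v 0 j| ^+ 2 - (`|u 0 j| * `|v 0 j|) *+ 2
  = (`|u 0 j| - `|v 0 j|) ^+ 2 by ring.
by rewrite real_exprn_even_ge0 // rpredB // normr_real.
Qed.

Lemma norm_cinner_lt1 u v : cnorm2 u <= 1 -> cnorm2 v < 1 -> `|cinner u v| < 1.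
Proof.
move=> u1 v1; rewrite -[_ < _]/((0 < 2)%N && _) -ltrMn2r.
by apply: le_lt_trans (norm_cinner_mul2 u v) _; rewrite mulr2n ler_ltD.
Qed.

Lemma norm_cinner_le1 u v : cnorm2 u <= 1 -> cnorm2 v <= 1 -> `|cinner u v| <= 1.
Proof.
move=> u1 v1; rewrite -[_ <= _]/((2 == 0)%N || _) -lerMn2r.
by apply: le_trans (norm_cinner_mul2 u v) _; rewrite mulr2n lerD.
Qed.

(** Schur product with a Gram kernel: each coordinate contributes a rank-one factor, which is
    absorbed into the coefficients, so positivity of [k] passes to the product. *)
Lemma kcomb_norm2_mul_cinner (k : T -> T -> R[i]) s :
  kcomb_norm2 (fun z w => k z w * cinner (y z) (y w)) s =
  \sum_(j < d) kcomb_norm2 k [seq (p.1 * (y p.2 0 j)^*, p.2) | p <- s].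
Proof.
rewrite /kcomb_norm2.
under [RHS]eq_bigr do rewrite big_map.
rewrite [RHS]exchange_big; apply: eq_bigr => p _.
under [RHS]eq_bigr do rewrite big_map.
rewrite [RHS]exchange_big; apply: eq_bigr => q _ /=.
rewrite /cinner mulrA mulr_sumr; apply: eq_bigr => j _.
by rewrite rmorphM /= conjCK; ring.
Qed.

Lemma psd_cinner_pow n : psd_kernel setT (fun z w => cinner (y z) (y w) ^+ n).
Proof.
elim: n => [|n IH] s _.
  rewrite /kcomb_norm2.
  have -> : \sum_(p <- s) \sum_(q <- s) p.1 * (q.1)^* * cinner (y q.2) (y p.2) ^+ 0
      = `|\sum_(p <- s) p.1| ^+ 2.
    rewrite normCK rmorph_sum mulr_suml; apply: eq_bigr => p _.
    by rewrite mulr_sumr; apply: eq_bigr => q _; rewrite expr0 mulr1.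
  by rewrite exprn_ge0.
have -> : (fun z w => cinner (y z) (y w) ^+ n.+1) =
    (fun z w => cinner (y z) (y w) ^+ n * cinner (y z) (y w)).
  by apply/funext => z; apply/funext => w; rewrite exprSr.
by rewrite kcomb_norm2_mul_cinner sumr_ge0 // => j _; exact: IH.
Qed.

(** Partial sums of the geometric series are positive by [psd_cinner_pow]; the remainder [b n] tends
    to 0 because only finitely many inner products, all of modulus below 1, occur. *)
Lemma psd_DA_kernel (A : set T) : (forall z, A z -> cball (y z)) ->
  psd_kernel A (fun z w => (1 - cinner (y z) (y w))^-1).
Proof.
move=> yA s sA; pose k z w := (1 - cinner (y z) (y w))^-1.
have lt1 p q : List.In p s -> List.In q s -> `|cinner (y q.2) (y p.2)| < 1.
  by move=> /sA/yA p1 /sA/yA q1; apply: norm_cinner_lt1 => //; exact: ltW.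
pose b n := kcomb_norm2 (fun z w => cinner (y z) (y w) ^+ n * k z w) s.
have partial n : 0 <= kcomb_norm2 k s - b n.
  have -> : kcomb_norm2 k s - b n =
      \sum_(i < n) kcomb_norm2 (fun z w => cinner (y z) (y w) ^+ i) s.
    rewrite /b /kcomb_norm2 [RHS]exchange_big /= -sumrB; apply: eq_big_List => p ps.
    rewrite [RHS]exchange_big /= -sumrB; apply: eq_big_List => q qs.
    rewrite -mulrBr -mulr_sumr; congr (_ * _).
    have ne : 1 - cinner (y q.2) (y p.2) != 0.
      rewrite subr_eq0; apply/eqP => E; have := lt1 _ _ ps qs.
      by rewrite -E normr1 ltxx.
    have E := subrX1 (cinner (y q.2) (y p.2)) n.
    apply: (mulfI ne); rewrite /k; set S := \sum_(i < n) _ in E *.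
    have -> : (1 - cinner (y q.2) (y p.2)) * S = 1 - cinner (y q.2) (y p.2) ^+ n.
      by rewrite -[1 - _]opprB mulNr -E opprB.
    by field.
  by apply: sumr_ge0 => i _; exact: psd_cinner_pow.
have b0 : b @ \oo --> (0 : R[i]).
  rewrite /b /kcomb_norm2.
  rewrite [X in _ --> X](_ : _ = \sum_(p <- s) \sum_(q <- s) p.1 * (q.1)^* * (0 * k q.2 p.2));
    last by rewrite big1 // => p _; rewrite big1 // => q _; rewrite mul0r mulr0.
  apply: cvg_sum_seq => p ps; apply: cvg_sum_seq => q qs.
  apply: cvgM; first exact: cvg_cst.
  apply: cvgM; last exact: cvg_cst.
  exact: cvg_geometric_complex (lt1 _ _ ps qs).
have c1 : (fun n => kcomb_norm2 k s - b n) @ \oo --> kcomb_norm2 k s.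
  by rewrite -[X in _ --> X]subr0; apply: cvgB b0; exact: cvg_cst.
(* Each term equals its own modulus, so the sequence also converges to the modulus of its limit, and
   the limit is nonnegative. *)
have c2 : (fun n => kcomb_norm2 k s - b n) @ \oo --> `|kcomb_norm2 k s|.
  have -> : (fun n => kcomb_norm2 k s - b n) = (fun n => `|kcomb_norm2 k s - b n|).
    by apply/funext => n; rewrite ger0_norm.
  exact: cvg_norm.
have -> : kcomb_norm2 (fun z w => (1 - cinner (y z) (y w))^-1) s = `|kcomb_norm2 k s|.
  exact: (cvg_unique _ c1 c2).
exact: normr_ge0.
Qed.

End DruryArvesonKernel.

(** * Derivatives along real lines in the complex plane *)

Lemma continuous_cR (R : realType) : continuous (@cR R).
Proof.
move=> x; apply/cvg_complexP => e e0.
have /cvgrPdist_lt /(_ _ e0) : (fun t : R => t) @ x --> x by exact: cvg_id.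
apply: filterS => t; rewrite /cR -rmorphB /= normc_def /= expr0n addr0 sqrtr_sqr.
by rewrite ltcR.
Qed.

Lemma continuous_Re (R : realType) : continuous (@complex.Re R).
Proof.
move=> x; apply/(@cvgrPdist_lt _ _ _ (nbhs x)) => e e0.
have /cvgrPdist_lt /(_ _ (cR_gt0 _ _ e0)) : (fun t : R[i] => t) @ x --> x by exact: cvg_id.
apply: filterS => t xt.
have -> : complex.Re x - complex.Re t = complex.Re (x - t) by case: (x) (t) => [? ?] [].
by rewrite -ltcR; apply: le_lt_trans (normc_ge_Re _) xt.
Qed.

(** The imaginary part is written as the real part of [- 'i * w], so that bounds proved for all
    [Re (c * G)] yield bounds on the modulus. *)
Lemma norm_complex_le (R : realType) (w : R[i]) (B : R) :
  `|complex.Re w| <= B -> `|complex.Re (- 'i%C * w)| <= B -> `|w| <= cR (B + B).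
Proof.
case: w => a b ha.
have -> : complex.Re (- 'i%C * Complex a b) = b.
  rewrite -[- 'i%C]/(Complex (- 0) (- 1)) -[Complex _ _ * _]/(Complex _ _) /=; ring.
rewrite [complex.Re (Complex a b)]/= in ha *; move=> hb.
have -> : Complex a b = cR a + 'i%C * cR b.
  by rewrite /cR; apply/eqP; rewrite eq_complex /=; apply/andP; split; apply/eqP; ring.
apply: le_trans (ler_normD _ _) _.
have nR (x : R) : `|cR x| = cR `|x| by rewrite normc_def /= expr0n addr0 sqrtr_sqr.
have ni : `|'i%C : R[i]| = 1 by rewrite normc_def /= expr0n expr1n add0r sqrtr1.
by rewrite normrM ni mul1r !nR /cR -rmorphD lecR lerD.
Qed.

Definition rdiff {R : realType} (G : R[i] -> R[i]) (v z L : R[i]) : Prop :=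
  (fun t : R => (cR t)^-1 * (G (z + cR t * v) - G z)) @ (0 : R)^' --> L.

(** The factor [c] reduces complex functions to real ones: [1] selects the real part, [- 'i] the
    imaginary part, and chain rule factors can be stored in it. *)
Lemma rdiff_is_derive (R : realType) (G : R[i] -> R[i]) (g : R -> R[i]) (c v L : R[i]) (t : R) :
  (forall h, g (t + h) = g t + cR h * v) -> rdiff G v (g t) L ->
  is_derive t (1 : R) (fun t => complex.Re (c * G (g t))) (complex.Re (c * L)).
Proof.
move=> gE D.
have C : (fun h => h^-1 *: (((fun t => complex.Re (c * G (g t))) \o shift t) (h *: (1 : R))
     - complex.Re (c * G (g t)))) @ (0 : R)^' --> complex.Re (c * L).
  have -> : (fun h => h^-1 *: (((fun t => complex.Re (c * G (g t))) \o shift t) (h *: (1 : R))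
     - complex.Re (c * G (g t)))) =
     (fun h : R => complex.Re (c * ((cR h)^-1 * (G (g t + cR h * v) - G (g t))))).
    apply/funext => h /=; rewrite -[h *: 1]/(h * 1) mulr1 (addrC h t) gE.
    rewrite mulrCA mulrBr; set a := c * _; set b := c * _.
    have -> : (cR h)^-1 = cR h^-1 by rewrite /cR fmorphV.
    by case: a b => [a1 a2] [b1 b2]; rewrite /cR /GRing.scale /= mul0r subr0.
  apply: (@cvg_comp _ _ _ _ (@complex.Re R)); last exact: continuous_Re.
  by apply: cvgM; [exact: cvg_cst|exact: D].
apply: DeriveDef; first by apply/cvg_ex; exists (complex.Re (c * L)); exact: C.
by apply: cvg_lim => //; exact: C.
Qed.

Lemma within_continuous_path (R : realType) (S : topologicalType) (D : set R[i])
    (B : set S) (G : R[i] -> R[i]) (g : S -> R[i]) (c : R[i]) :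
  {within D, continuous G} -> continuous g -> (forall x, B x -> D (g x)) ->
  {within B, continuous (fun x => complex.Re (c * G (g x)))}.
Proof.
move=> /subspace_continuousP cG cg BD; apply/subspace_continuousP => x Bx.
apply: (@cvg_comp _ _ _ _ (@complex.Re R)); last exact: continuous_Re.
apply: cvgM; first exact: cvg_cst.
apply: cvg_trans (cG (g x) (BD _ Bx)).
move=> U; rewrite /within /nbhs /= => HU.
near=> y => By; have : D (g y) by exact: BD.
by near: y; exact: (cg x _ HU).
Unshelve. all: by end_near. Qed.

(** * One-variable estimates up to an endpoint *)

Lemma bounded_on_unit_itv (R : realType) (g : R -> R) :
  {within `[0, 1], continuous g} -> exists B, forall x : R, 0 <= x <= 1 -> `|g x| <= B.
Proof.
move=> cg.
have [a _ Ha] := EVT_max ler01 cg; have [b _ Hb] := EVT_min ler01 cg.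
exists (`|g a| + `|g b|) => x x01; have xI : x \in `[0, 1]%R by rewrite in_itv.
rewrite ler_norml; have := Ha x xI; have := Hb x xI.
have := ler_norm (g a); have := ler_norm (- g b); rewrite normrN => h1 h2 h3 h4.
by apply/andP; split; have := normr_ge0 (g a); have := normr_ge0 (g b); lra.
Qed.

Lemma MVT_ineq (R : realType) (g g1 : R -> R) (B : R) :
  {within `[0, 1], continuous g} ->
  (forall x : R, 0 < x < 1 -> is_derive x (1 : R) g (g1 x)) ->
  forall x : R, 0 <= x <= 1 -> (forall y : R, 0 < y < x -> `|g1 y| <= B) ->
  `|g x - g 0| <= B * x.
Proof.
move=> cg dg x /andP[x0 x1] hB.
have [->|xn0] := eqVneq x 0; first by rewrite subrr normr0 mulr0.
have {}x0 : 0 < x by rewrite lt_neqAle eq_sym xn0.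
have dg' y : y \in `]0, x[%R -> is_derive y (1 : R) g (g1 y).
  by rewrite in_itv /= => /andP[y0 yx]; apply: dg; rewrite y0 (lt_le_trans yx).
have cg' : {within `[0, x], continuous g}.
  by apply: continuous_subspaceW cg => y /=; rewrite !in_itv /= => /andP[-> /le_trans->].
have [c] := MVT x0 dg' cg'; rewrite in_itv /= subr0 => /hB cB ->.
by rewrite normrM (gtr0_norm x0) ler_pM2r.
Qed.

(** The endpoint 0 stands for a boundary point, where [g1] and [g2] are only continuous extensions
    of the derivatives. The second-order bound is the mean value inequality for [g y - g1 0 * y],
    whose derivative is controlled through [g2]. *)
Lemma taylor2_ineq (R : realType) (g g1 g2 : R -> R) :
  {within `[0, 1], continuous g} -> {within `[0, 1], continuous g1} ->
  {within `[0, 1], continuous g2} ->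
  (forall x : R, 0 < x < 1 -> is_derive x (1 : R) g (g1 x) /\ is_derive x (1 : R) g1 (g2 x)) ->
  exists B, forall x : R, 0 <= x <= 1 ->
    `|g x - g 0| <= B * x /\ `|g x - g 0 - g1 0 * x| <= B * x ^+ 2.
Proof.
move=> c0 c1 c2 D.
have [B1 H1] := bounded_on_unit_itv _ _ c1; have [B2 H2] := bounded_on_unit_itv _ _ c2.
have B10 : 0 <= B1 by apply: le_trans (H1 0 _) => //; rewrite lexx ler01.
have B20 : 0 <= B2 by apply: le_trans (H2 0 _) => //; rewrite lexx ler01.
have sub (y x : R) : 0 <= x <= 1 -> 0 < y < x -> 0 <= y <= 1.
  by move=> /andP[_ x1] /andP[y0 yx]; rewrite ltW //= (le_trans (ltW yx)).
exists (B1 + B2) => x xI; have /andP[x0 x1] := xI; split.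
  have := MVT_ineq _ g g1 B1 c0 (fun x xI => (D x xI).1) x xI
    (fun y yx => H1 y (sub _ _ xI yx)); have : 0 <= B2 * x by rewrite mulr_ge0.
  lra.
pose r y := g y + (- g1 0) * y.
have cr : {within `[0, 1], continuous r}.
  move=> y; apply: cvgD; first exact: c0.
  apply: cvgM; first exact: cvg_cst.
  by apply: (@continuous_subspaceT _ _ _ (fun y : R => y)) => z; exact: cvg_id.
have dr (y : R) : 0 < y < 1 -> is_derive y (1 : R) r (g1 y - g1 0).
  move=> /D[d _].
  have dl : is_derive y (1 : R) (fun y => - g1 0 * y) (- g1 0).
    apply: (is_derive_horner _ _ ((- g1 0)%:P * 'X)); first by move=> z; rewrite !hornerE.
    by rewrite !poly.derivE !hornerE.
  exact: (is_derive_add _ _ _ _ _ _ d dl).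
have hB (y : R) : 0 < y < x -> `|g1 y - g1 0| <= B2 * x.
  move=> yx; have yI := sub _ _ xI yx; have /andP[y0 y1] := yx.
  have := MVT_ineq _ g1 g2 B2 c1 (fun x xI => (D x xI).2) y yI
    (fun z zy => H2 z (sub _ _ yI zy)).
  by move=> h; apply: le_trans h _; rewrite ler_wpM2l // ltW.
have := MVT_ineq _ r _ _ cr dr x xI hB; rewrite /r mulr0 addr0.
have -> : g x + - g1 0 * x - g 0 = g x - g 0 - g1 0 * x by ring.
move=> h; apply: le_trans h _; have := mulr_ge0 B10 (sqr_ge0 x).
by rewrite mulrDl -mulrA -expr2; lra.
Qed.

(** A positive [g1 0] would stay positive to the right by continuity, and [g] would rise above
    [g 0]. *)
Lemma right_derivative_at_max (R : realType) (g g1 : R -> R) (b : R) : 0 < b ->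
  {within `[0, b], continuous g} -> {within `[0, b], continuous g1} ->
  (forall x : R, 0 < x < b -> is_derive x (1 : R) g (g1 x)) ->
  (forall x : R, 0 <= x <= b -> g x <= g 0) -> g1 0 <= 0.
Proof.
move=> b0 c0 /(continuous_within_itvP _ b0)[_ c1 _] D gmax.
rewrite leNgt; apply/negP => g10.
have [x [x0 xb xpos]] : exists x, [/\ 0 < x, x < b & forall y, 0 < y < x -> 0 < g1 y].
  have : \forall x \near (0 : R)^'+, 0 < g1 x by exact: cvgr_gt c1 _ g10.
  rewrite near_withinE -nbhs_nearE => /nbhs_ballP[e /= e0 He].
  have m0 : 0 < Num.min e b by rewrite lt_min e0 b0.
  have [me mb] : Num.min e b <= e /\ Num.min e b <= b by split; rewrite ge_min lexx ?orbT.
  exists (Num.min e b / 2); split; [by rewrite divr_gt0|lra|].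
  move=> y /andP[y0 ym]; apply: (He y) => //.
  by rewrite /ball /= sub0r normrN gtr0_norm //; lra.
have dg' y : y \in `]0, x[%R -> is_derive y (1 : R) g (g1 y).
  by rewrite in_itv /= => /andP[y0 yx]; apply: D; rewrite y0 (lt_trans yx).
have cg' : {within `[0, x], continuous g}.
  apply: continuous_subspaceW c0 => y /=; rewrite !in_itv /= => /andP[-> yx] /=.
  exact: le_trans yx (ltW xb).
have [c] := MVT x0 dg' cg'; rewrite in_itv /= subr0 => /xpos cpos E.
have := gmax x ltac:(by rewrite !ltW); have : 0 < g1 c * x by rewrite mulr_gt0.
lra.
Qed.

(** * From the vector-valued map to scalar functions *)

Lemma continuous_cinner (R : realType) (d : nat) (q : 'rV[R[i]]_d) :
  continuous (fun v : 'rV[R[i]]_d => cinner v q).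
Proof.
move=> v; apply: (@cvg_sum_seq _ _ _ (nbhs v)) => j _.
by apply: cvgM; [exact: coord_continuous|exact: cst_continuous].
Qed.

Lemma cinnerBl (R : realType) (d : nat) (u v q : 'rV[R[i]]_d) :
  cinner (u - v) q = cinner u q - cinner v q.
Proof. by rewrite /cinner -sumrB; apply: eq_bigr => j _; rewrite !mxE mulrBl. Qed.

Lemma cinnerZl (R : realType) (d : nat) (a : R[i]) (u q : 'rV[R[i]]_d) :
  cinner (a *: u) q = a * cinner u q.
Proof. by rewrite /cinner mulr_sumr; apply: eq_bigr => j _; rewrite !mxE mulrA. Qed.

Lemma rdiff_cinner (R : realType) (d : nat) (F : R[i] -> 'rV[R[i]]_d) v z L q :
  has_rpartial F v z L -> rdiff (fun z => cinner (F z) q) v z (cinner L q).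
Proof.
move=> H; rewrite /rdiff.
have -> : (fun t : R => (cR t)^-1 * (cinner (F (z + cR t * v)) q - cinner (F z) q)) =
    (fun v => cinner v q) \o (fun t : R => (cR t)^-1 *: (F (z + cR t * v) - F z)).
  by apply/funext => t /=; rewrite cinnerZl cinnerBl.
exact: cvg_comp H (continuous_cinner _ _ _ _).
Qed.

Lemma cvg_dnbhs (T U : topologicalType) (g : T -> U) (x : T) :
  {for x, continuous g} -> (forall t, t != x -> g t != g x) -> g @ x^' --> (g x)^'.
Proof.
move=> cg inj A HA; have : nbhs x (g @^-1` [set y | y != g x -> A y]) := cg _ HA.
by apply: filterS => t At tx; apply/At/inj.
Qed.

Lemma cvg_cR_mul_dnbhs0 (R : realType) (v : R[i]) : v != 0 ->
  (fun t : R => cR t * v) @ (0 : R)^' --> (0 : R[i])^'.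
Proof.
move=> v0; have := @cvg_dnbhs R R[i] (fun t => cR t * v) 0.
rewrite [cR 0 * v]mul0r; apply.
  by apply: cvgM; [exact: continuous_cR|exact: cst_continuous].
move=> t t0; rewrite mulf_neq0 //; apply: contra_neq t0.
by rewrite /cR => /complexI.
Qed.

Lemma near_odisc (R : realType) (z : R[i]) : odisc z -> \forall w \near z, odisc w.
Proof.
move=> z1; rewrite /odisc /= in z1.
have e0 : 0 < 1 - `|z| by rewrite subr_gt0.
have id_z : (fun w : R[i] => w) @ z --> z by exact: cvg_id.
have H := @cvgr_dist_lt _ _ _ (nbhs z) _ id z id_z _ e0.
near=> w; have zw : `|z - w| < 1 - `|z| by near: w; exact: H.
rewrite /odisc /=.
have -> : w = z - (z - w) by ring.
by apply: le_lt_trans (ler_normB _ _) _; rewrite addrC -ltrBrDr.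
Unshelve. all: by end_near. Qed.

(** The increments in [derivable f z 1] are complex scalars, so it is complex differentiability;
    restricting them to [t v] gives the derivative along [v]. Openness of the disc lets [F] replace
    [f] near [z]. *)
Lemma has_rpartial_complex (R : realType) (d : nat) (f F : R[i] -> 'rV[R[i]]_d)
    (z : R[i]) (L : 'rV[R[i]]_d) :
  (forall z, odisc z -> F z = f z) -> odisc z -> derivable f z 1 ->
  has_rpartial F 1 z L -> forall v, has_rpartial F v z (v *: L).
Proof.
move=> Ff z1 df FL.
have H v : has_rpartial F v z (v *: 'D_1 f z).
  (* For [v = 0] the increments [t v] do not stay away from 0, so the punctured limit cannot be
     composed. *)
  have [->|v0] := eqVneq v 0.
    rewrite /has_rpartial scale0r.
    have -> : (fun t : R => (cR t)^-1 *: (F (z + cR t * 0) - F z)) = (fun=> 0).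
      by apply/funext => t; rewrite mulr0 addr0 subrr scaler0.
    exact: cvg_cst.
  have C : (fun t : R => v *: ((cR t * v)^-1 *: (f ((cR t * v) *: 1 + z) - f z))) @ (0 : R)^'
      --> v *: 'D_1 f z.
    apply: cvgZr.
    exact: (cvg_comp _ _ (cvg_cR_mul_dnbhs0 _ _ v0) df).
  apply: cvg_trans C; apply: near_eq_cvg.
  have zt : (fun t : R => z + cR t * v) @ (0 : R)^' --> z.
    rewrite -[X in _ --> X]addr0; apply: cvgD; first exact: cvg_cst.
    exact: cvg_trans (cvg_cR_mul_dnbhs0 _ _ v0) (@cvg_within _ _ _ _).
  have := zt _ (near_odisc _ _ z1); rewrite !near_simpl => near1.
  near=> t.
  rewrite -[(cR t * v) *: 1]/((cR t * v) * 1) mulr1 scalerA invfM mulrCA mulfV // mulr1.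
  rewrite (addrC _ z) -!Ff //.
  by near: t.
have -> : L = 'D_1 f z.
  have := H 1; rewrite scale1r => H1; exact: (cvg_unique _ FL H1).
exact: H.
Unshelve. all: by end_near. Qed.

Lemma rdiff_real_scale (R : realType) (G : R[i] -> R[i]) (z L : R[i]) (a : R) :
  a != 0 -> rdiff G 1 z L -> rdiff G (cR a) z (cR a * L).
Proof.
move=> a0 H; rewrite /rdiff.
have -> : (fun t : R => (cR t)^-1 * (G (z + cR t * cR a) - G z)) =
    (fun t : R => cR a * ((cR (t * a))^-1 * (G (z + cR (t * a) * 1) - G z))).
  apply/funext => t; rewrite mulr1.
  have -> : cR (t * a) = cR t * cR a by rewrite /cR rmorphM.
  rewrite invfM mulrA [_ * (_ * _)]mulrCA divff ?mulr1 //.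
  by apply: contra_neq a0; rewrite /cR => /complexI.
apply: cvgM; first exact: cvg_cst.
have ta : (fun t : R => t * a) @ (0 : R)^' --> (0 : R)^'.
  have := @cvg_dnbhs R R (fun t => t * a) 0.
  rewrite mul0r; apply; last by move=> t t0; rewrite mulf_neq0.
  by apply: cvgM; [exact: cvg_id|exact: cst_continuous].
exact: (cvg_comp _ _ ta H).
Qed.

Lemma odiscE (R : realType) (x y : R) : @odisc R (Complex x y) = (sqn2 (x, y) < 1) :> Prop.
Proof.
rewrite /odisc /sqn2 /= normc_def -[1]/(cR 1) /cR ltcR /=.
by rewrite -{1}sqrtr1 ltr_sqrt ?ltr01.
Qed.

Lemma cdiscE (R : realType) (x y : R) : @cdisc R (Complex x y) = (sqn2 (x, y) <= 1) :> Prop.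
Proof.
rewrite /cdisc /sqn2 /= normc_def -[1]/(cR 1) /cR lecR /=.
by rewrite -{1}sqrtr1 ler_sqrt ?ler01.
Qed.

Lemma continuous_Complex (R : realType) : continuous (fun q : R * R => Complex q.1 q.2).
Proof.
have -> : (fun q : R * R => Complex q.1 q.2) = (fun q => cR q.1 + 'i%C * cR q.2).
  apply/funext => q; apply/eqP; rewrite eq_complex /=.
  by apply/andP; split; apply/eqP; ring.
move=> q; apply: cvgD.
  by apply: (@cvg_comp _ _ _ _ (@cR R)); [exact: cvg_fst|exact: continuous_cR].
apply: cvgM; first exact: cst_continuous.
by apply: (@cvg_comp _ _ _ _ (@cR R)); [exact: cvg_snd|exact: continuous_cR].
Qed.

(** * Holomorphic functions of class C^2 on the closed disc *)

(* P is the complex derivative of phi; Q and S are the partial derivatives of P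
   in x and y. *)
Definition hol2 {R : realType} (phi P Q S : R[i] -> R[i]) : Prop :=
  [/\ [/\ {within @cdisc R, continuous phi}, {within @cdisc R, continuous P},
          {within @cdisc R, continuous Q} & {within @cdisc R, continuous S}] &
      forall z, odisc z -> [/\ forall v, rdiff phi v z (v * P z),
          rdiff P 1 z (Q z) & rdiff P (iC R) z (S z)]].

Section Hol2.
Context {R : realType}.
Variables phi P Q S : R[i] -> R[i].
Hypothesis H : hol2 phi P Q S.

Let cphi : {within @cdisc R, continuous phi}. Proof. by case: H => -[]. Qed.
Let cP : {within @cdisc R, continuous P}. Proof. by case: H => -[]. Qed.
Let cQ : {within @cdisc R, continuous Q}. Proof. by case: H => -[]. Qed.
Let cS : {within @cdisc R, continuous S}. Proof. by case: H => -[]. Qed.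

Lemma Complex_shift_l (x y h : R) : Complex (x + h) y = Complex x y + cR h * 1.
Proof. by rewrite mulr1 /cR; apply/eqP; rewrite eq_complex /= addr0 !eqxx. Qed.

Lemma Complex_shift_r (x y h : R) : Complex x (y + h) = Complex x y + cR h * iC R.
Proof.
rewrite /cR /iC; apply/eqP; rewrite eq_complex /=.
by apply/andP; split; apply/eqP; ring.
Qed.

Lemma hol2_derive (c : R[i]) (x y : R) : sqn2 (x, y) < 1 ->
  [/\ is_derive x (1 : R) (fun x => complex.Re (c * phi (Complex x y)))
        (complex.Re (c * P (Complex x y))),
      is_derive y (1 : R) (fun y => complex.Re (c * phi (Complex x y)))
        (complex.Re (c * iC R * P (Complex x y))),
      is_derive x (1 : R) (fun x => complex.Re (c * P (Complex x y)))
        (complex.Re (c * Q (Complex x y))) &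
      is_derive y (1 : R) (fun y => complex.Re (c * P (Complex x y)))
        (complex.Re (c * S (Complex x y)))].
Proof.
rewrite -odiscE => z1; have [_ /(_ _ z1)[D1 D2 D3]] := H.
split.
- rewrite -[P _]mul1r.
  exact: (rdiff_is_derive _ _ (fun x => Complex x y) _ _ _ _ (Complex_shift_l x y) (D1 1)).
- rewrite -mulrA.
  exact: (rdiff_is_derive _ _ (fun y => Complex x y) _ _ _ _ (Complex_shift_r x y) (D1 _)).
- exact: (rdiff_is_derive _ _ (fun x => Complex x y) _ _ _ _ (Complex_shift_l x y) D2).
- exact: (rdiff_is_derive _ _ (fun y => Complex x y) _ _ _ _ (Complex_shift_r x y) D3).
Qed.

Lemma near_sqn2_lt1 (x y : R) : sqn2 (x, y) < 1 ->
  \forall q \near (x, y), sqn2 q < 1.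
Proof. by move=> lt1; exact: cvgr_lt (@continuous_sqn2 R (x, y)) _ lt1. Qed.

Lemma continuous_at_interior (G : R[i] -> R[i]) (c : R[i]) (x y : R) :
  {within @cdisc R, continuous G} -> sqn2 (x, y) < 1 ->
  {for (x, y), continuous (fun q : R * R => complex.Re (c * G (Complex q.1 q.2)))}.
Proof.
move=> cG lt1.
have cB : {within [set q : R * R | sqn2 q < 1],
    continuous (fun q => complex.Re (c * G (Complex q.1 q.2)))}.
  apply: within_continuous_path cG (@continuous_Complex R) _ => -[a b] /= ab.
  by rewrite cdiscE ltW.
have oB : open [set q : R * R | sqn2 q < 1].
  rewrite openE => -[a b] /= ab; exact: near_sqn2_lt1.
move: cB; rewrite continuous_open_subspace //; apply.
by rewrite inE.
Qed.

(** The two terms are the pure second partials of [Re phi]. Since [hol2] gives [P] only its two real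
    partials, the relation between them comes from the symmetry of mixed partials. *)
Lemma hol2_harmonic (x y : R) : sqn2 (x, y) < 1 ->
  complex.Re (1 * Q (Complex x y)) + complex.Re (iC R * S (Complex x y)) = 0.
Proof.
move=> lt1.
have ii : - iC R * iC R = 1 by rewrite mulNr -expr2 sqr_i opprK.
(* Symmetry of the mixed partials of Im phi, with first partials Im P and Re P. *)
have E : complex.Re (- iC R * S (Complex x y)) = complex.Re (1 * Q (Complex x y)).
  apply: (@mixed_partials_eq R (fun x y => complex.Re (- iC R * phi (Complex x y)))
    (fun x y => complex.Re (- iC R * P (Complex x y)))
    (fun x y => complex.Re (1 * P (Complex x y)))
    (fun x y => complex.Re (- iC R * S (Complex x y)))
    (fun x y => complex.Re (1 * Q (Complex x y)))).
  - near=> q; have q1 : sqn2 (q.1, q.2) < 1.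
      by near: q; apply: filterS (near_sqn2_lt1 _ _ lt1) => -[].
    have [d1 d2 _ d4] := hol2_derive (- iC R) _ _ q1.
    have [_ _ d3 _] := hol2_derive 1 _ _ q1.
    by split => //; rewrite ii in d2.
  - exact: continuous_at_interior.
  - exact: continuous_at_interior.
rewrite -E mulNr.
have ReN (w : R[i]) : complex.Re (- w) = - complex.Re w by case: w.
by rewrite ReN addNr.
Unshelve. all: by end_near. Qed.

Lemma hol2_hopf :
  (forall z, cdisc z -> complex.Re (phi z) <= 1) ->
  (forall z, odisc z -> complex.Re (phi z) < 1) ->
  exists2 e : R, 0 < e & forall x y, 3 / 4 <= sqn2 (x, y) <= 1 ->
    complex.Re (phi (Complex x y)) <= 1 - e * (1 - sqn2 (x, y)).
Proof.
move=> le1 lt1.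
have [||||e e0 He] := @hopf_estimate R (fun x y => complex.Re (1 * phi (Complex x y)))
    (fun x y => complex.Re (1 * P (Complex x y)))
    (fun x y => complex.Re (iC R * P (Complex x y)))
    (fun x y => complex.Re (1 * Q (Complex x y)))
    (fun x y => complex.Re (iC R * S (Complex x y))).
- move=> x y xy1; have [d1 d2 d3 _] := hol2_derive 1 _ _ xy1.
  have [_ _ _ d4] := hol2_derive (iC R) _ _ xy1.
  by rewrite mul1r in d2; split => //; exact: hol2_harmonic.
- apply: within_continuous_path cphi (@continuous_Complex R) _ => -[a b] /= ab.
  by rewrite cdiscE.
- by move=> x y xy; rewrite mul1r le1 // cdiscE.
- by move=> x y xy; rewrite mul1r lt1 // odiscE.
exists e => // x y xy; have := He x y xy; by rewrite mul1r.
Qed.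

Lemma cR_Complex (x : R) : cR x = Complex x 0. Proof. by []. Qed.

(** The condition [s ^+ 2 = 1] lets one argument serve both endpoints 1 and -1. *)
Lemma radial_disc (s x : R) : s ^+ 2 = 1 ->
  (0 <= x <= 1 -> cdisc (cR (s * (1 - x)))) /\ (0 < x < 1 -> odisc (cR (s * (1 - x)))).
Proof.
move=> s2; split=> /andP[x0 x1]; rewrite ?cdiscE ?odiscE /sqn2 /= expr0n addr0 exprMn s2 mul1r;
  nra.
Qed.

Lemma continuous_radius (s : R) : continuous (fun x : R => cR (s * (1 - x))).
Proof.
move=> x; apply: (@cvg_comp _ _ _ (fun x : R => s * (1 - x)) (@cR R)); last exact: continuous_cR.
apply: cvgM; first exact: cst_continuous.
by apply: cvgB; [exact: cst_continuous|exact: cvg_id].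
Qed.

Lemma radial_taylor_Re (c : R[i]) (s : R) : s ^+ 2 = 1 ->
  exists B, forall x : R, 0 <= x <= 1 ->
    `|complex.Re (c * (phi (cR (s * (1 - x))) - phi (cR s)))| <= B * x /\
    `|complex.Re (c * (phi (cR (s * (1 - x))) - phi (cR s) + cR x * (cR s * P (cR s))))|
      <= B * x ^+ 2.
Proof.
move=> s2; pose g x := cR (s * (1 - x)).
have sN0 : - s != 0 by rewrite oppr_eq0; apply/eqP => s0; move: s2; rewrite s0; lra.
have gE x h : g (x + h) = g x + cR h * cR (- s).
  by rewrite /g /cR -rmorphM -rmorphD; congr (_%:C%C); ring.
have cD x : `[0, 1] x -> cdisc (g x).
  by rewrite /= in_itv /=; exact: (radial_disc _ _ s2).1.
pose c1 := c * cR (- s); pose c2 := c1 * cR (- s).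
have [||||B HB] := @taylor2_ineq R (fun x => complex.Re (c * phi (g x)))
  (fun x => complex.Re (c1 * P (g x))) (fun x => complex.Re (c2 * Q (g x))).
- exact: within_continuous_path cphi (continuous_radius s) cD.
- exact: within_continuous_path cP (continuous_radius s) cD.
- exact: within_continuous_path cQ (continuous_radius s) cD.
- move=> x xI; have [_ /(_ _ ((radial_disc _ _ s2).2 xI))[D1 D2 _]] := H.
  split.
    rewrite /c1 -mulrA.
    exact: (rdiff_is_derive _ _ g _ _ _ _ (gE x) (D1 _)).
  (* The radius is a real multiple of the direction 1, so [Q] alone gives the derivative of [P]
     along it. *)
  rewrite /c2 -mulrA.
  exact: (rdiff_is_derive _ _ g _ _ _ _ (gE x) (rdiff_real_scale _ _ _ _ _ sN0 D2)).
exists B => x xI; have [h1 h2] := HB x xI.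
have ReB (a b : R[i]) : complex.Re (a - b) = complex.Re a - complex.Re b.
  by case: a b => [? ?] [].
have g0 : g 0 = cR s by rewrite /g subr0 mulr1.
rewrite g0 in h1 h2; split; first by rewrite mulrBr ReB.
have -> : c * (phi (cR (s * (1 - x))) - phi (cR s) + cR x * (cR s * P (cR s))) =
   c * phi (g x) - c * phi (cR s) - c1 * P (cR s) * cR x.
  by rewrite /c1 /g; have -> : cR (- s) = - cR s by [rewrite /cR rmorphN]; ring.
rewrite !ReB.
have -> : complex.Re (c1 * P (cR s) * cR x) = complex.Re (c1 * P (cR s)) * x => //.
by case: (c1 * P (cR s)) => a b /=; rewrite mulr0 subr0.
Qed.

Lemma radial_taylor (s : R) : s ^+ 2 = 1 ->
  exists B, forall x : R, 0 <= x <= 1 ->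
    `|phi (cR (s * (1 - x))) - phi (cR s)| <= cR (B * x) /\
    `|phi (cR (s * (1 - x))) - phi (cR s) + cR x * (cR s * P (cR s))| <= cR (B * x ^+ 2).
Proof.
move=> s2; have [B1 H1] := radial_taylor_Re 1 s s2.
have [B2 H2] := radial_taylor_Re (- 'i%C) s s2.
exists ((Num.max B1 B2) *+ 2) => x xI; have /andP[x0 _] := xI.
have [h1 h3] := H1 x xI; have [h2 h4] := H2 x xI.
rewrite !mul1r in h1 h3.
have [m1 m2] : B1 <= Num.max B1 B2 /\ B2 <= Num.max B1 B2.
  by split; rewrite le_max lexx ?orbT.
rewrite !mulr2n !mulrDl; split; apply: norm_complex_le.
- by apply: le_trans h1 _; rewrite ler_wpM2r.
- by apply: le_trans h2 _; rewrite ler_wpM2r.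
- by apply: le_trans h3 _; rewrite ler_wpM2r // sqr_ge0.
- by apply: le_trans h4 _; rewrite ler_wpM2r // sqr_ge0.
Qed.

(** [A] is the outward normal derivative at [s]. Maximality along every slanted segment gives
    [Re A - m * Im A >= 0] for all real [m], which forces [Im A = 0]; the Hopf estimate along the
    radius makes [Re A] positive. *)
Lemma boundary_derivative (s : R) : s ^+ 2 = 1 -> phi (cR s) = 1 ->
  (forall z, cdisc z -> complex.Re (phi z) <= 1) ->
  (forall z, odisc z -> complex.Re (phi z) < 1) ->
  exists2 a : R, 0 < a & cR s * P (cR s) = cR a.
Proof.
move=> s2 phi1 le1 lt1; set A := cR s * P (cR s).
have ReMN (a b : R[i]) : complex.Re (1 * (- a * b)) = - complex.Re (a * b).
  by rewrite mul1r mulNr; case: (a * b).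
(* Re phi is maximal at s, so it does not increase along s (1 - t (1 + i m)). *)
have half m : 0 <= complex.Re (Complex 1 m * A).
  (* The squared modulus along the segment is [1 - t (2 - t (1 + m^2))]; up to [t = b] the bracket
     is at least 1, so the segment stays in the disc. *)
  pose b := (1 + m ^+ 2)^-1.
  have m0 : 0 < 1 + m ^+ 2 by have := sqr_ge0 m; lra.
  have b0 : 0 < b by rewrite invr_gt0.
  have bm : b * (1 + m ^+ 2) = 1 by rewrite mulVf // gt_eqF.
  pose v := - (cR s * Complex 1 m); pose g t := cR s + cR t * v.
  have gE t : g t = Complex (s * (1 - t)) (- (s * t * m)).
    rewrite /g /v /cR; apply/eqP; rewrite eq_complex /=.
    by apply/andP; split; apply/eqP; ring.
  have nE t : sqn2 (s * (1 - t), - (s * t * m)) = 1 - t * (2 - t * (1 + m ^+ 2)).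
    rewrite /sqn2 /=; transitivity (s ^+ 2 * ((1 - t) ^+ 2 + t ^+ 2 * m ^+ 2)); first ring.
    by rewrite s2; ring.
  have le_t t : 0 <= t <= b -> t * (1 + m ^+ 2) <= 1.
    by move=> /andP[_ tb]; rewrite -[leRHS]bm ler_pM2r.
  have cD t : `[0, b] t -> cdisc (g t).
    rewrite /= in_itv /= => tI; rewrite gE cdiscE nE.
    by have := le_t _ tI; move: tI => /andP[t0 _]; nra.
  have oD t : 0 < t < b -> odisc (g t).
    move=> /andP[t0 tb]; rewrite gE odiscE nE.
    by have := le_t t ltac:(by rewrite !ltW); nra.
  have cg : continuous g.
    move=> t; apply: cvgD; first exact: cst_continuous.
    by apply: cvgM; [exact: continuous_cR|exact: cst_continuous].
  have g0 : g 0 = cR s by rewrite /g mul0r addr0.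
  have : complex.Re (1 * v * P (g 0)) <= 0.
    apply: (@right_derivative_at_max R (fun t => complex.Re (1 * phi (g t)))
      (fun t => complex.Re (1 * v * P (g t))) b b0).
    - exact: within_continuous_path cphi cg cD.
    - exact: within_continuous_path cP cg cD.
    - move=> t tI; have [_ /(_ _ (oD _ tI))[D1 _ _]] := H.
      rewrite -mulrA; apply: (rdiff_is_derive _ _ g _ _ _ _ _ (D1 v)) => h.
      by rewrite /g /cR rmorphD mulrDl addrA.
    - move=> t tI; rewrite g0 phi1 !mul1r; apply: le1; apply: cD.
      by rewrite /= in_itv.
  rewrite g0 /v -mulrA ReMN oppr_le0.
  by have -> : cR s * Complex 1 m * P (cR s) = Complex 1 m * A by rewrite /A; ring.
have [e e0 He] := hol2_hopf le1 lt1.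
have ReA : e <= complex.Re A.
  pose g t := cR (s * (1 - t)).
  (* The Hopf estimate needs [(1 - t)^2 >= 3/4], and [0.9^2 = 0.81]. *)
  have b0 : 0 < (1 / 10 : R) by lra.
  have g0 : g 0 = cR s by rewrite /g subr0 mulr1.
  have gE x h : g (x + h) = g x + cR h * cR (- s).
    by rewrite /g /cR -rmorphM -rmorphD; congr (_%:C%C); ring.
  have cD x : `[0, 1 / 10] x -> cdisc (g x).
    rewrite /= in_itv /= => /andP[x0 x1]; apply: (radial_disc _ _ s2).1.
    by rewrite x0; lra.
  have : complex.Re (1 * cR (- s) * P (g 0)) + e <= 0.
    (* The Hopf bound is [1 - e (2 t - t^2)], at most [1 - e t], so adding [e t] still leaves the
       maximum at [t = 0]. *)
    apply: (@right_derivative_at_max R (fun t => complex.Re (1 * phi (g t)) + e * t)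
      (fun t => complex.Re (1 * cR (- s) * P (g t)) + e) (1 / 10) b0).
    - move=> t; apply: cvgD.
        exact: (within_continuous_path _ _ _ _ _ _ _ cphi (continuous_radius s) cD).
      apply: cvgM; first exact: cvg_cst.
      by apply: (@continuous_subspaceT _ _ _ (fun y : R => y)) => z; exact: cvg_id.
    - move=> t; apply: cvgD; last exact: cvg_cst.
      exact: (within_continuous_path _ _ _ _ _ _ _ cP (continuous_radius s) cD).
    - move=> t /andP[t0 t1]; apply: is_derive_add.
        have tI : 0 < t < 1 by rewrite t0; lra.
        have [_ /(_ _ ((radial_disc _ _ s2).2 tI))[D1 _ _]] := H.
        rewrite -mulrA; exact: (rdiff_is_derive _ _ g _ _ _ _ (gE t) (D1 _)).
      apply: (is_derive_horner _ _ (e%:P * 'X)); first by move=> z; rewrite !hornerE.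
      by rewrite !poly.derivE !hornerE.
    - move=> t /andP[t0 t1]; rewrite g0 phi1 !mul1r mulr0 addr0.
      have := He (s * (1 - t)) 0; rewrite /sqn2 /= expr0n addr0 exprMn s2 mul1r -cR_Complex.
      have -> : (3 / 4 <= (1 - t) ^+ 2 <= 1) = true by apply/andP; split; nra.
      move=> /(_ isT); rewrite -/(g t).
      have : 0 <= e * (t * (1 - t)) by rewrite !mulr_ge0 // ?ltW //; lra.
      by nra.
  rewrite g0 -mulrA (_ : cR (- s) = - cR s); last by rewrite /cR rmorphN.
  by rewrite ReMN -/A addrC subr_le0.
exists (complex.Re A); first exact: lt_le_trans e0 ReA.
have : complex.Im A = 0.
  apply/eqP/negPn/negP => im0.
  (* With this slope [Re A - m * Im A] equals -1. *)
  have := half ((complex.Re A + 1) / complex.Im A).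
  have -> : complex.Re (Complex 1 ((complex.Re A + 1) / complex.Im A) * A) = -1.
    by case: A im0 {half ReA} => a b /= im0; field.
  lra.
by case: A {half ReA} => a b /= ->.
Qed.

End Hol2.

(** * Radial approach to the boundary *)

(** The derivatives are chosen before [q], because several test vectors are used later: [p], the
    coordinate vectors, and the values [f v]. *)
Lemma attached_disc_hol2 (R : realType) (d : nat) (V : set 'rV[R[i]]_d)
    (f F : R[i] -> 'rV[R[i]]_d) :
  attached_disc V f F -> exists Fx Fxx Fxy : R[i] -> 'rV[R[i]]_d, forall q,
    hol2 (fun z => cinner (F z) q) (fun z => cinner (Fx z) q)
         (fun z => cinner (Fxx z) q) (fun z => cinner (Fxy z) q).
Proof.
move=> [_ [[_ df _] [Ff [cF [Fx [Fy [Fxx [Fxy [Fyx [Fyy [[cFx _] [cFxx cFxy] _ D]]]]]]]] _]]].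
exists Fx, Fxx, Fxy => q.
have cq (G : R[i] -> 'rV[R[i]]_d) : {within @cdisc R, continuous G} ->
    {within @cdisc R, continuous (fun z => cinner (G z) q)}.
  by move=> cG z; exact: (cvg_comp _ _ (cG z) (continuous_cinner _ _ _ _)).
split; first by split; exact: cq.
move=> z z1; have [[D1 _] [D2 D3] _] := D z z1.
split; [move=> v|exact: rdiff_cinner|exact: rdiff_cinner].
rewrite -cinnerZl; apply: rdiff_cinner.
exact: (has_rpartial_complex _ _ _ _ _ _ Ff z1 (df z z1)).
Qed.

Lemma cinnerBr (R : realType) (d : nat) (u v q : 'rV[R[i]]_d) :
  cinner q (u - v) = cinner q u - cinner q v.
Proof. by rewrite cinnerC cinnerBl rmorphB /= -!cinnerC. Qed.

Lemma cR_ge0 (R : realType) (x : R) : (0 <= cR x) = (0 <= x).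
Proof. by rewrite /cR ler0c. Qed.

Lemma cRD (R : realType) (x y : R) : cR (x + y) = cR x + cR y.
Proof. by rewrite /cR rmorphD. Qed.

Lemma cRM (R : realType) (x y : R) : cR (x * y) = cR x * cR y.
Proof. by rewrite /cR rmorphM. Qed.

Lemma norm_cR (R : realType) (x : R) : 0 <= x -> `|cR x| = cR x.
Proof. by move=> x0; rewrite ger0_norm // cR_ge0. Qed.

(** Expanding around [p], [1 - <u, v> = <p - u, p> + conj <p - v, p> - <p - u, p - v>]: each of the
    first two terms contributes [t], and the last is a sum of [d] products of first-order
    quantities. *)
Lemma kernel_denominator_bound (R : realType) (d : nat) (p u v : 'rV[R[i]]_d) (C t : R) :
  cinner p p = 1 -> 0 <= C -> 0 <= t ->
  `|cinner (p - u) p - cR t| <= cR (C * t ^+ 2) ->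
  `|cinner (p - v) p - cR t| <= cR (C * t ^+ 2) ->
  (forall j, `|(p - u) 0 j| <= cR (C * t)) -> (forall j, `|(p - v) 0 j| <= cR (C * t)) ->
  `|1 - cinner u v - cR (t + t)| <= cR ((C + C + C ^+ 2 *+ d) * t ^+ 2).
Proof.
move=> pp C0 t0 hu hv hju hjv.
have E : 1 - cinner u v - cR (t + t) = (cinner (p - u) p - cR t)
   + (cinner (p - v) p - cR t)^* - cinner (p - u) (p - v).
  rewrite rmorphB /= (_ : (cR t)^* = cR t); last first.
    by rewrite conj_Creal // ger0_real // cR_ge0.
  rewrite -cinnerC !cinnerBl !cinnerBr.
  by rewrite pp cRD; ring.
have dd : `|cinner (p - u) (p - v)| <= cR (C ^+ 2 * t ^+ 2 *+ d).
  rewrite /cinner; apply: le_trans (ler_norm_sum _ _ _) _.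
  apply: (@le_trans _ _ (\sum_(j < d) cR (C ^+ 2 * t ^+ 2))).
    apply: ler_sum => j _; rewrite normrM norm_conjC -exprMn expr2 cRM.
    by apply: ler_pM.
  by rewrite sumr_const card_ord /cR rmorphMn.
rewrite E; apply: le_trans (ler_normB _ _) _.
have -> : (C + C + C ^+ 2 *+ d) * t ^+ 2 = C * t ^+ 2 + C * t ^+ 2 + C ^+ 2 * t ^+ 2 *+ d.
  by rewrite !mulrDl mulrnAl.
rewrite !cRD; apply: lerD dd; apply: le_trans (ler_normD _ _) _.
by rewrite norm_conjC; exact: lerD.
Qed.

(** The condition [K t <= 1] keeps the modulus of [X] above [t], so the difference of inverses is at
    most [K t^2 / (t * 2 t)]. *)
Lemma inv_perturbation (R : realType) (X : R[i]) (K t : R) :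
  0 < t -> 0 <= K -> K * t <= 1 -> `|X - cR (t + t)| <= cR (K * t ^+ 2) ->
  `|X^-1 - (cR (t + t))^-1| <= cR K.
Proof.
move=> t0 K0 Kt hX; set Y := cR (t + t).
have Y0 : 0 < Y by apply: cR_gt0; lra.
have tX : cR t <= `|X|.
  have h : Y <= `|X| + cR t.
    rewrite -[Y]norm_cR; last lra.
    have -> : cR (t + t) = X - (X - Y) by rewrite /Y; ring.
    apply: le_trans (ler_normB _ _) _; rewrite lerD2l; apply: le_trans hX _.
    by rewrite /cR lecR; nra.
  by move: h; rewrite /Y cRD lerD2r.
have X0 : 0 < `|X| by apply: lt_le_trans tX; exact: cR_gt0.
have Xn0 : X != 0 by rewrite -normr_gt0.
have inv_diff (x y : R[i]) : x != 0 -> y != 0 -> x^-1 - y^-1 = - ((x - y) / (x * y)).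
  by move=> x0 y0; field; rewrite ?x0 ?y0.
rewrite inv_diff // ?gt_eqF //.
rewrite normrN normrM normfV normrM (gtr0_norm Y0) ler_pdivrMr ?mulr_gt0 //.
apply: le_trans hX _.
apply: (@le_trans _ _ (cR K * (cR t * Y))); first by rewrite -!cRM /cR lecR; nra.
by rewrite ler_wpM2l ?cR_ge0 // ler_wpM2r // ltW.
Qed.

Lemma kf_herm (R : realType) (d : nat) (f : R[i] -> 'rV[R[i]]_d) z w :
  kf f z w = (kf f w z)^*.
Proof. by rewrite /kf fmorphV rmorphB rmorph1 /= -cinnerC. Qed.

Lemma cvg_to_radius_end (R : realType) (a : R) : 0 < a ->
  (fun t : R => 1 - t / a) @ (0 : R)^'+ --> (1 : R)^'-.
Proof.
move=> a0 U HU.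
have c0 : (fun t : R => 1 - t / a) @ (0 : R) --> (1 - 0 / a : R).
  apply: cvgB; first exact: cst_continuous.
  by apply: cvgM; [exact: cvg_id|exact: cst_continuous].
rewrite mul0r subr0 in c0.
have : nbhs (0 : R) ((fun t : R => 1 - t / a) @^-1` [set y | y < 1 -> U y]) := c0 _ HU.
apply: filterS => t Ut t_gt0; apply: Ut.
by rewrite ltrBlDr ltrDl divr_gt0.
Qed.

Lemma radial_point_odisc (R : realType) (s a t : R) :
  s ^+ 2 = 1 -> 0 < a -> 0 < t < a -> odisc (cR (s * (1 - t / a))).
Proof.
move=> s2 a0 /andP[t0 ta]; apply: (radial_disc _ _ s2).2.
by rewrite divr_gt0 //= ltr_pdivrMr // mul1r.
Qed.

Section RadialApproach.
Context {R : realType} {d : nat}.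
Variables (F Fx Fxx Fxy : R[i] -> 'rV[R[i]]_d) (p : 'rV[R[i]]_d) (s a : R).
Hypothesis HF : forall q, hol2 (fun z => cinner (F z) q) (fun z => cinner (Fx z) q)
         (fun z => cinner (Fxx z) q) (fun z => cinner (Fxy z) q).
Hypothesis s2 : s ^+ 2 = 1.
Hypothesis Fs : F (cR s) = p.
Hypothesis pp : cinner p p = 1.
Hypothesis a0 : 0 < a.
Hypothesis Da : cR s * cinner (Fx (cR s)) p = cR a.

Let z t := cR (s * (1 - t / a)).

Lemma cinner_radial_lipschitz q : exists2 C, 0 <= C & forall t, 0 <= t <= a ->
  `|cinner (p - F (z t)) q| <= cR (C * t).
Proof.
have [B HB] := radial_taylor _ _ _ _ (HF q) s s2.
exists (`|B| / a) => [|t /andP[t0 ta]]; first by rewrite divr_ge0 // ltW.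
have [h _] := HB (t / a) ltac:(by rewrite divr_ge0 ?(ltW a0) //= ler_pdivrMr // mul1r).
rewrite cinnerBl -Fs distrC; apply: le_trans h _.
rewrite /cR lecR mulrAC -mulrA ler_wpM2r ?ler_norm //.
by rewrite divr_ge0 // ltW.
Qed.

(** Second-order accuracy is required only in the direction [p], where [Da] makes the first-order
    term exactly [t]. Single coordinates enter the kernel through products of two, so first order
    suffices for them. *)
Lemma radial_defect : exists2 C, 0 <= C & forall t, 0 <= t <= a ->
  `|cinner (p - F (z t)) p - cR t| <= cR (C * t ^+ 2) /\
  forall j, `|(p - F (z t)) 0 j| <= cR (C * t).
Proof.
have [B HB] := radial_taylor _ _ _ _ (HF p) s s2.
have coord (v : 'rV[R[i]]_d) j : cinner v (delta_mx 0 j) = v 0 j.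
  rewrite /cinner (bigD1 j) //= big1 ?addr0 => [|k kj].
    by rewrite mxE !eqxx conjC1 mulr1.
  by rewrite mxE eqxx (negbTE kj) conjC0 mulr0.
have /choice[C HC] : forall j : 'I_d, exists Cj : R, 0 <= Cj /\
    forall t, 0 <= t <= a -> `|(p - F (z t)) 0 j| <= cR (Cj * t).
  move=> j.
  have [C C0 HC] := cinner_radial_lipschitz (delta_mx 0 j).
  by exists C; split => // t tI; rewrite -coord; exact: HC.
have sC0 : 0 <= \sum_(j < d) C j by apply: sumr_ge0 => j _; have [] := HC j.
have B0 : 0 <= `|B| / a ^+ 2 by rewrite divr_ge0 // sqr_ge0.
exists (`|B| / a ^+ 2 + \sum_(j < d) C j) => [|t tI]; first exact: addr_ge0.
have /andP[t0 ta] := tI; split.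
  have [_ h] := HB (t / a) ltac:(by rewrite divr_ge0 ?(ltW a0) //= ler_pdivrMr // mul1r).
  rewrite Da Fs pp -cRM divfK ?gt_eqF // in h.
  rewrite cinnerBl pp -normrN; have -> : - (1 - cinner (F (z t)) p - cR t) =
    cinner (F (z t)) p - 1 + cR t by ring.
  apply: le_trans h _; rewrite /cR lecR.
  have h1 : B * (t / a) ^+ 2 <= `|B| / a ^+ 2 * t ^+ 2.
    have -> : `|B| / a ^+ 2 * t ^+ 2 = `|B| * (t / a) ^+ 2 by field; rewrite gt_eqF.
    by rewrite ler_wpM2r ?sqr_ge0 // ler_norm.
  have := mulr_ge0 sC0 (sqr_ge0 t); rewrite mulrDl; lra.
move=> j; have [_ /(_ t tI) h] := HC j; apply: le_trans h _.
rewrite /cR lecR ler_wpM2r // (bigD1 j) //=.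
have : 0 <= \sum_(i < d | i != j) C i by apply: sumr_ge0 => i _; have [] := HC i.
lra.
Qed.

(** The limit depends on the endpoint only through [p], so the two radial limits cancel when the
    endpoints share [p]. *)
Lemma cvg_kernel_radial (v : 'rV[R[i]]_d) : cinner p v != 1 ->
  (fun t => (1 - cinner (F (z t)) v)^-1) @ (0 : R)^'+ --> (1 - cinner p v)^-1.
Proof.
move=> ne1; apply: cvgV; first by rewrite subr_eq0 eq_sym.
apply: cvgB; first exact: cvg_cst.
have [C C0 HC] := cinner_radial_lipschitz v.
apply/cvg_complexP => e e0; near=> t.
have t0 : 0 < t by near: t; exact: nbhs_right_gt.
have ta : t < a by near: t; exact: nbhs_right_lt.
(* [C + 1] keeps the divisor positive when [C = 0]. *)
have te : t < e / (C + 1) by near: t; apply: nbhs_right_lt; rewrite divr_gt0 //; lra.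
rewrite -cinnerBl; apply: le_lt_trans (HC t _) _; first by rewrite !ltW.
rewrite /cR ltcR; rewrite ltr_pdivlMr in te; last lra.
nra.
Unshelve. all: by end_near. Qed.

End RadialApproach.

Theorem theorem2p1 (R : realType) (d : nat) (V : set 'rV[R[i]]_d)
    (f F : R[i] -> 'rV[R[i]]_d) (h : R[i] -> R[i]) (L1 Lm1 : R[i]) :
  attached_disc V f F ->
  F (- 1) = F 1 ->
  in_Hf f h ->
  (fun r : R => h (cR r)) @ (1 : R)^'- --> L1 ->
  (fun r : R => h (- cR r)) @ (1 : R)^'- --> Lm1 ->
  L1 = Lm1.
Proof.
move=> HV F11 hH hL1 hLm1; have [Fx [Fxx [Fxy HF]]] := attached_disc_hol2 _ _ _ _ _ HV.
have [[_ _ fball] [_ [Ff _ Fbd]]] := HV.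
set p := F 1 in F11.
have p2 : cnorm2 p = 1.
  by apply/Fbd; rewrite ?normr1 // /cdisc /= normr1.
have pp : cinner p p = 1.
  by rewrite -p2 /cinner /cnorm2; apply: eq_bigr => j _; rewrite normCK.
have Flt z : odisc z -> cnorm2 (F z) < 1 by move=> z1; rewrite Ff //; exact: fball.
have Fle z : cdisc z -> cnorm2 (F z) <= 1.
  rewrite /cdisc /= le_eqVlt => /orP[/eqP z1|/Flt/ltW//].
  have cz : cdisc z by rewrite /cdisc /= z1.
  by rewrite ((Fbd z cz).2 z1).
have Re_le (w : R[i]) : cR (complex.Re w) <= `|w|.
  by apply: le_trans (normc_ge_Re w); rewrite /cR lecR ler_norm.
have le1 z : cdisc z -> complex.Re (cinner (F z) p) <= 1.
  move=> /Fle z1; rewrite -lecR; apply: le_trans (Re_le _) _.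
  by apply: norm_cinner_le1; rewrite ?p2.
have lt1 z : odisc z -> complex.Re (cinner (F z) p) < 1.
  move=> /Flt z1; rewrite -ltcR; apply: le_lt_trans (Re_le _) _.
  by rewrite cinnerC norm_conjC; apply: norm_cinner_lt1; rewrite ?p2.
have s1 : (1 : R) ^+ 2 = 1 by rewrite expr1n.
have s2 : (- 1 : R) ^+ 2 = 1 by rewrite sqrrN expr1n.
have F1 : F (cR (1 : R)) = p by [].
have Fm1 : F (cR (- 1 : R)) = p by rewrite -F11 /cR rmorphN.
have E1 : cinner (F (cR (1 : R))) p = 1 by rewrite F1.
have Em1 : cinner (F (cR (- 1 : R))) p = 1 by rewrite Fm1.
have [a a0 Da] := boundary_derivative _ _ _ _ (HF p) 1 s1 E1 le1 lt1.
have [b b0 Db] := boundary_derivative _ _ _ _ (HF p) (- 1) s2 Em1 le1 lt1.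
pose z t := cR (1 * (1 - t / a)); pose w t := cR (- 1 * (1 - t / b)).
have [C1 C10 H1] := radial_defect _ _ _ _ _ _ _ HF s1 F1 pp a0 Da.
have [C2 C20 H2] := radial_defect _ _ _ _ _ _ _ HF s2 Fm1 pp b0 Db.
pose C := C1 + C2.
have C0 : 0 <= C by rewrite addr_ge0.
pose K := C + C + C ^+ 2 *+ d.
have K0 : 0 <= K by rewrite !addr_ge0 // mulrn_wge0 // sqr_ge0.
have psd : psd_kernel (@odisc R) (kf f) := psd_DA_kernel _ _ fball.
have herm := kf_herm R d f.
(* Each of the four kernel values differs from [1 / (2 t)] by at most [K]; the extra 1 makes the
   bound positive. *)
apply: (@in_rkhs_curve_limits R _ (@odisc R) (kf f) h _ ((0 : R)^'+) _ z w (K *+ 4 + 1)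
  L1 Lm1 psd herm hH).
- by have := mulrn_wge0 4 K0; lra.
- near=> t.
  have t0 : 0 < t by near: t; exact: nbhs_right_gt.
  have ta : t < a by near: t; exact: nbhs_right_lt.
  have tb : t < b by near: t; exact: nbhs_right_lt.
  have tK : K * t <= 1.
    have : t < (K + 1)^-1 by near: t; apply: nbhs_right_lt; rewrite invr_gt0; lra.
    by rewrite -[X in _ < X]mul1r ltr_pdivlMr; [nra|lra].
  have z1 : odisc (z t) by apply: radial_point_odisc; rewrite ?t0.
  have w1 : odisc (w t) by apply: radial_point_odisc; rewrite ?t0.
  split => //.
  have weaken x C' (X : R[i]) : 0 <= C' -> 0 <= x -> C' <= C ->
      `|X| <= cR (C' * x) -> `|X| <= cR (C * x).
    move=> ? ? CC hX; apply: le_trans hX _; by rewrite /cR lecR ler_wpM2r.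
  have C1C : C1 <= C by rewrite /C; lra.
  have C2C : C2 <= C by rewrite /C; lra.
  have [z2 z3] := H1 t ltac:(by rewrite !ltW).
  have [w2 w3] := H2 t ltac:(by rewrite !ltW).
  have {}z2 := weaken _ _ _ C10 (sqr_ge0 t) C1C z2.
  have {}w2 := weaken _ _ _ C20 (sqr_ge0 t) C2C w2.
  have {}z3 j := weaken _ _ _ C10 (ltW t0) C1C (z3 j).
  have {}w3 j := weaken _ _ _ C20 (ltW t0) C2C (w3 j).
  have kb x y : odisc x -> odisc y ->
      `|cinner (p - F x) p - cR t| <= cR (C * t ^+ 2) ->
      `|cinner (p - F y) p - cR t| <= cR (C * t ^+ 2) ->
      (forall j, `|(p - F x) 0 j| <= cR (C * t)) ->
      (forall j, `|(p - F y) 0 j| <= cR (C * t)) ->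
      `|kf f x y - (cR (t + t))^-1| <= cR K.
    move=> x1 y1 hx hy hxj hyj; rewrite /kf -!Ff //; apply: inv_perturbation => //.
    exact: kernel_denominator_bound pp C0 (ltW t0) hx hy hxj hyj.
  have k1 := kb _ _ z1 z1 z2 z2 z3 z3; have k2 := kb _ _ w1 w1 w2 w2 w3 w3.
  have k3 := kb _ _ z1 w1 z2 w2 z3 w3; have k4 := kb _ _ w1 z1 w2 z2 w3 z3.
  set D := _ - kf f (w t) (z t).
  (* [D] is the squared norm of [k_z - k_w]. Being nonnegative, it equals its modulus, to which the
     triangle inequality applies. *)
  have D0 : 0 <= D.
    have := psd [:: (1, z t); (- 1, w t)].
    have := kcomb_norm2_add_pair (kf f) [::] 1 (z t) (w t) herm.
    rewrite /= => ->; rewrite /kcomb_norm2 /kcomb !big_nil subrr conjC0 conjC1.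
    rewrite !mulr0 !mul1r !add0r.
    by apply => q [<-//|[<-//|[]]].
  rewrite -(ger0_norm D0).
  (* The singular term occurs twice with each sign and can be subtracted from every kernel value for
     free. *)
  have -> : D = (kf f (z t) (z t) - (cR (t + t))^-1) + (kf f (w t) (w t) - (cR (t + t))^-1)
     - (kf f (z t) (w t) - (cR (t + t))^-1) - (kf f (w t) (z t) - (cR (t + t))^-1).
    by rewrite /D; ring.
  apply: (@le_trans _ _ (cR (K + K + K + K))); last by rewrite /cR lecR; lra.
  have -> : cR (K + K + K + K) = cR K + cR K + cR K + cR K by rewrite !cRD.
  apply: le_trans (ler_normB _ _) _; apply: lerD k4.
  apply: le_trans (ler_normB _ _) _; apply: lerD k3.
  by apply: le_trans (ler_normD _ _) _; apply: lerD.
- move=> v v1.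
  have ne1 : cinner p (f v) != 1.
    apply/eqP => E; have : `|cinner p (f v)| < 1.
      by apply: norm_cinner_lt1; [rewrite p2|exact: fball].
    by rewrite E normr1 ltxx.
  have cz := cvg_kernel_radial _ _ _ _ _ _ _ HF s1 F1 a0 (f v) ne1.
  have cw := cvg_kernel_radial _ _ _ _ _ _ _ HF s2 Fm1 b0 (f v) ne1.
  have c0 : (fun t => (1 - cinner (F (z t)) (f v))^-1 - (1 - cinner (F (w t)) (f v))^-1)
      @ (0 : R)^'+ --> (0 : R[i]).
    by rewrite -(subrr (1 - cinner p (f v))^-1); exact: cvgB cz cw.
  have Hc := (cvg_complexP _ _ _ _ _ _).2 c0.
  apply/cvg_complexP => e e0; near=> t.
  have t0 : 0 < t by near: t; exact: nbhs_right_gt.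
  have ta : t < a by near: t; exact: nbhs_right_lt.
  have tb : t < b by near: t; exact: nbhs_right_lt.
  have z1 : odisc (z t) by apply: radial_point_odisc; rewrite ?t0.
  have w1 : odisc (w t) by apply: radial_point_odisc; rewrite ?t0.
  have Et : kf f (z t) v - kf f (w t) v =
      (1 - cinner (F (z t)) (f v))^-1 - (1 - cinner (F (w t)) (f v))^-1.
    by rewrite /kf !Ff.
  by rewrite Et; near: t; exact: Hc.
- have -> : h \o z = (fun r => h (cR r)) \o (fun t => 1 - t / a).
    by apply/funext => t /=; rewrite /z mul1r.
  exact: cvg_comp (cvg_to_radius_end _ _ a0) hL1.
- have -> : h \o w = (fun r => h (- cR r)) \o (fun t => 1 - t / b).
    by apply/funext => t /=; rewrite /w mulN1r /cR rmorphN.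
  exact: cvg_comp (cvg_to_radius_end _ _ b0) hLm1.
Unshelve. all: by end_near. Qed.
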